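(* Let $c>0$ and let $X$ be a random variable with CDF $F$ such that $\mathbb{P}(X>\epsilon)\le\exp(-c\epsilon)$ and $\mathbb{P}(X\le-\epsilon)\le\exp(-c\epsilon)$ for all $\epsilon\ge0$. Let $\rho:\mathcal{L}\to\mathbb{R}$ be a risk measure of type (T2) with parameters $\alpha_1,\alpha_2,\alpha_3,L_1,L_2,L_3,K_1,K_2,\gamma$. Fix $\tau>0$ and let $\rho_n=\rho(F_n|_\tau)$. Then, for every $n\ge1$ and every $\epsilon>0$ such that $$\epsilon'=\epsilon-\frac{L_2}{c\alpha_2}\exp(-\alpha_2cK_1\tau)-\frac{L_3}{c\alpha_3}\exp(-\alpha_3cK_2\tau)>0\quad\text{and}\quad\left(\frac{\epsilon'}{L_1\tau^\gamma}\right)^{1/\alpha_1}>\frac{384}{c\sqrt n},$$ we have $$\mathbb{P}\left(|\rho_n-\rho(X)|>\epsilon\right)\le\exp\left(-\frac{n}{\frac{32}{c^2}+\frac4c\left(\left(\frac{\epsilon'}{L_1\tau^\gamma}\right)^{1/\alpha_1}-\frac{384}{c\sqrt n}\right)}\left(\left(\frac{\epsilon'}{L_1\tau^\gamma}\right)^{1/\alpha_1}-\frac{384}{c\sqrt n}\right)^2\right).$$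
   Context: $\mathcal{L}$ is the set of CDFs on $\mathbb{R}$. A risk measure is a map $\rho:\mathcal{L}\to\mathbb{R}$; if $X$ has CDF $F$, $\rho(X)$ means $\rho(F)$. For a CDF $G$ and $\tau>0$, $G|_\tau(x)=G(x)\mathbf 1\{-\tau\le x<\tau\}+\mathbf 1\{x\ge\tau\}$. $\rho$ is of type (T2) with parameters $\alpha_1,\alpha_2,\alpha_3,L_1,L_2,L_3,K_1,K_2,\gamma$ (all positive constants, with $\alpha_1,K_1,K_2\le1$) if for all $F,G\in\mathcal{L}$ and every $\tau>0$, $$|\rho(F)-\rho(G|_\tau)|\le L_1(W_1(F,G))^{\alpha_1}\tau^\gamma+L_2\int_{K_1\tau}^\infty[1-F(z)]^{\alpha_2}dz+L_3\int_{-\infty}^{-K_2\tau}[F(z)]^{\alpha_3}dz.$$ $W_1$ is the 1-Wasserstein distance: $W_1(F_1,F_2)=\inf\int_{\mathbb{R}^2}|x-y|\,dF(x,y)$ over joint distributions $F$ with marginals $F_1,F_2$; equivalently $W_1(F_1,F_2)=\int_{-\infty}^{\infty}|F_1(s)-F_2(s)|\,ds$. Given i.i.d. samples $X_1,\dots,X_n$ from $F$, $F_n(x)=\frac1n\sum_{i=1}^n\mathbf 1\{X_i\le x\}$ is the empirical distribution function. *)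

(* Defs.v *)
From HB Require Import structures.
From mathcomp Require Import all_boot all_order all_algebra.
From mathcomp Require Import all_classical all_reals all_analysis.

Set Implicit Arguments.
Unset Strict Implicit.
Unset Printing Implicit Defensive.

Import Order.TTheory GRing.Theory Num.Theory.
Import numFieldNormedType.Exports.

Local Open Scope classical_set_scope.
Local Open Scope ring_scope.

Notation CDF R := (@cumulativeBounded R 0 1).

Section truncation.
Context {R : realType}.

Definition trunc_fun (tau : R) (G : R -> R) (x : R) : R :=
  G x * (- tau <= x < tau)%R%:R + (tau <= x)%R%:R.

Variables (tau : R) (G : CDF R).

Let cdf_ge0 x : 0 <= G x.
Proof.
rewrite leNgt; apply/negP => Gx0.
have /cvgr_gt/(_ _ Gx0) GN := cumulativeNy G.
have /filter_ex[y [yx]] : \forall y \near -oo, y <= x /\ G x < G y.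
  by near=> y; split; near: y => //; exact: nbhs_ninfty_le.
by apply/negP; rewrite -leNgt (cumulative_is_nondecreasing G).
Unshelve. all: by end_near. Qed.

Let cdf_le1 x : G x <= 1.
Proof.
rewrite leNgt; apply/negP => Gx1.
have /cvgr_lt/(_ _ Gx1) GN := cumulativey G.
have /filter_ex[y [yx]] : \forall y \near +oo, x <= y /\ G y < G x.
  by near=> y; split; near: y => //; apply: nbhs_pinfty_ge; rewrite num_real.
by apply/negP; rewrite -leNgt (cumulative_is_nondecreasing G).
Unshelve. all: by end_near. Qed.

Let trunc_nondecreasing : nondecreasing (trunc_fun tau G).
Proof.
move=> x y xy; rewrite /trunc_fun.
have := cumulative_is_nondecreasing G _ _ xy.
have := cdf_ge0 x; have := cdf_ge0 y; have := cdf_le1 x; have := cdf_le1 y.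
case: (leP tau x) => tx.
  rewrite (le_trans tx xy) !andbF ltNge (le_trans tx xy) andbF !mulr0.
  by [].
case: (leP (- tau) x) => ntx; last first.
  rewrite /= mulr0 add0r => *.
  by rewrite addr_ge0// mulr_ge0.
rewrite (le_trans ntx xy)/= mulr1 addr0.
by case: (leP tau y) => ty; rewrite ?mulr0 ?mulr1 ?addr0 ?add0r.
Qed.

Let trunc_right_continuous : right_continuous (trunc_fun tau G).
Proof.
move=> x; have [tx|xt] := leP tau x.
  rewrite {2}/trunc_fun [x < _]ltNge tx andbF mulr0 add0r.
  apply: cvg_near_cst; near=> y; apply/eqP.
  have ty : tau <= y by rewrite (le_trans tx).
  by rewrite /trunc_fun [y < _]ltNge ty andbF mulr0 add0r.
have [tx|xNt] := leP (- tau) x.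
  rewrite {2}/trunc_fun tx xt leNgt xt /= mulr1 addr0.
  apply: cvg_trans (cumulative_is_right_continuous G x).
  apply: near_eq_cvg; near=> y.
  have ty : - tau <= y by rewrite (le_trans tx).
  have yt : y < tau by near: y; exact: nbhs_right_lt.
  by rewrite /trunc_fun ty yt leNgt yt /= mulr1 addr0.
rewrite {2}/trunc_fun leNgt xNt leNgt xt /= mulr0 addr0.
apply: cvg_near_cst; near=> y; apply/eqP.
have yt : y < tau by near: y; exact: nbhs_right_lt.
have yNt : y < - tau by near: y; exact: nbhs_right_lt.
by rewrite /trunc_fun leNgt yNt leNgt yt /= mulr0 addr0.
Unshelve. all: by end_near. Qed.

Let trunc_Ny : trunc_fun tau G @ -oo --> (0 : R).
Proof.
apply: cvg_near_cst; near=> y; apply/eqP.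
have yt : y < tau by near: y; apply: nbhs_ninfty_lt; rewrite num_real.
have yNt : y < - tau by near: y; apply: nbhs_ninfty_lt; rewrite num_real.
by rewrite /trunc_fun leNgt yNt leNgt yt /= mulr0 addr0.
Unshelve. all: by end_near. Qed.

Let trunc_y : trunc_fun tau G @ +oo --> (1 : R).
Proof.
apply: cvg_near_cst; near=> y; apply/eqP.
have ty : tau <= y by near: y; apply: nbhs_pinfty_ge; rewrite num_real.
by rewrite /trunc_fun [y < _]ltNge ty andbF mulr0 add0r.
Unshelve. all: by end_near. Qed.

HB.instance Definition _ := isCumulative.Build R _ R (trunc_fun tau G)
  trunc_nondecreasing trunc_right_continuous.
HB.instance Definition _ := isCumulativeBounded.Build R 0 1 (trunc_fun tau G)
  trunc_Ny trunc_y.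

Definition trunc_cdf : CDF R := trunc_fun tau G.

End truncation.

Section empirical.
Context {R : realType}.

(* The proof of 0 < n is carried as an argument because the empirical
   distribution function of an empty sample is not a CDF. *)
Definition ecdf_fun (n : nat) (n_gt0 : (0 < n)%N) (x : 'I_n -> R) (t : R) : R :=
  n%:R^-1 * \sum_(i < n) (x i <= t)%R%:R.

Variables (n : nat) (n_gt0 : (0 < n)%N) (x : 'I_n -> R).

Let ecdf_nondecreasing : nondecreasing (ecdf_fun n_gt0 x).
Proof.
move=> s t st; rewrite /ecdf_fun ler_wpM2l ?invr_ge0// ler_sum// => i _.
by case: (leP (x i) s) => // xs; rewrite (le_trans xs st).
Qed.

Let ecdf_right_continuous : right_continuous (ecdf_fun n_gt0 x).
Proof.
move=> s.
have H i : \forall t \near s^'+, (x i <= t) = (x i <= s).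
  have [xs|sx] := leP (x i) s; near=> t; first by rewrite (le_trans xs).
  by apply/negbTE; rewrite -ltNge; near: t; exact: nbhs_right_lt.
apply: cvg_near_cst; near=> t; apply/eqP.
have Ht : forall i, (x i <= t) = (x i <= s).
  by near: t; exact: filter_forall.
rewrite /ecdf_fun; under eq_bigr do rewrite Ht.
by [].
Unshelve. all: by end_near. Qed.

Let ecdf_Ny : ecdf_fun n_gt0 x @ -oo --> (0 : R).
Proof.
apply: cvg_near_cst; near=> t; apply/eqP.
have H : forall i, t < x i.
  by near: t; apply: filter_forall => i; apply: nbhs_ninfty_lt; rewrite num_real.
rewrite /ecdf_fun big1 ?mulr0// => i _.
by rewrite leNgt H.
Unshelve. all: by end_near. Qed.

Let ecdf_y : ecdf_fun n_gt0 x @ +oo --> (1 : R).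
Proof.
apply: cvg_near_cst; near=> t; apply/eqP.
have H : forall i, x i <= t.
  by near: t; apply: filter_forall => i; apply: nbhs_pinfty_ge; rewrite num_real.
rewrite /ecdf_fun (eq_bigr (fun=> 1)) => [|i _]; last by rewrite H.
by rewrite sumr_const card_ord mulVf// pnatr_eq0 -lt0n.
Unshelve. all: by end_near. Qed.

HB.instance Definition _ := isCumulative.Build R _ R (ecdf_fun n_gt0 x)
  ecdf_nondecreasing ecdf_right_continuous.
HB.instance Definition _ := isCumulativeBounded.Build R 0 1 (ecdf_fun n_gt0 x)
  ecdf_Ny ecdf_y.

Definition ecdf : CDF R := ecdf_fun n_gt0 x.

End empirical.

Section wasserstein.
Context {R : realType}.
Local Open Scope ereal_scope.

Definition is_coupling (F1 F2 : CDF R) (pi : probability (R * R)%type R) : Prop :=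
  (forall x, pi [set z | z.1 <= x]%R = (F1 x)%:E) /\
  (forall x, pi [set z | z.2 <= x]%R = (F2 x)%:E).

(* Extended-real valued: the distance may be +oo for heavy-tailed arguments. *)
Definition wasserstein1 (F1 F2 : CDF R) : \bar R :=
  ereal_inf [set \int[pi]_z `|z.1 - z.2|%:E | pi in is_coupling F1 F2].

End wasserstein.

Section type_T2.
Context {R : realType}.
Local Open Scope ereal_scope.

(* The inequality is stated in \bar R since any of the three terms on its
   right-hand side may be +oo, in which case it holds trivially. *)
Definition type_T2 (rho : CDF R -> R)
    (alpha1 alpha2 alpha3 L1 L2 L3 K1 K2 gamma : R) : Prop :=
  [/\ [/\ 0 < alpha1 <= 1, 0 < alpha2 & 0 < alpha3]%R,
      [/\ 0 < L1, 0 < L2 & 0 < L3]%R,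
      [/\ 0 < K1 <= 1, 0 < K2 <= 1 & 0 < gamma]%R &
      forall (F G : CDF R) (tau : R), (0 < tau)%R ->
        `|rho F - rho (trunc_cdf tau G)|%:E <=
          L1%:E * wasserstein1 F G `^ alpha1 * (tau `^ gamma)%:E
          + L2%:E * \int[lebesgue_measure]_(z in `[(K1 * tau)%R, +oo[)
                      ((1 - F z) `^ alpha2)%:E
          + L3%:E * \int[lebesgue_measure]_(z in `]-oo, (- (K2 * tau))%R])
                      (F z `^ alpha3)%:E].

End type_T2.

Section independence.
Context d (T : measurableType d) (R : realType) (P : probability T R).

Definition mutually_independent (I : finType) (X : I -> {RV P >-> R}) : Prop :=
  forall (J : {set I}) (A : I -> set R), (forall i, measurable (A i)) ->
    P (\bigcap_(i in [set` J]) X i @^-1` A i) =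
    (\prod_(i in J) P (X i @^-1` A i))%E.

Definition iid_with_cdf (n : nat) (X : 'I_n -> {RV P >-> R}) (F : CDF R) : Prop :=
  mutually_independent X /\ forall i r, cdf (X i) r = (F r)%:E.

End independence.

(* Main.v *)
(** The empirical distribution function depends on the sample in a coordinatewise
    1/n-Lipschitz way for the distance [int |F - G|], which dominates [W_1] by the
    quantile coupling. Averaging out the coordinates of the sample one at a time
    bounds the exponential moments of [int |F - F_n|]: for a Lipschitz function
    of one coordinate X, symmetrization and convexity of cosh reduce the
    centered Laplace transform to [E cosh (2 s X)], which the exponential tails
    control. Together with the variance bound
    [E |F s - F_n s| <= exp (- c |s| / 2) / sqrt n], which gives
    [E int |F - F_n| <= 4 / (c sqrt n)], Chernoff's bound yields a
    Bernstein inequality for [int |F - F_n|]. Finally (T2) turns a deviation of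
    rho into one of [W_1], the two tail integrals being at most the two
    exponential terms subtracted from eps. *)

(* (T2) compares [rho F] with [rho] of the truncated [G] through the distance from [F] to the
   untruncated [G], so the concentration argument never sees [tau]. The summands are unbounded,
   which rules out a bounded-difference inequality and explains the detour through [cosh]: with
   [th = 2 c s], exponential tails give [E cosh (th X) <= 1 + 8 s^2 / (1 - 4 s^2)], and since
   [4 s^2 <= 2 s] this is a Bernstein-type bound with variance factor 16 and scale 2 in the unit
   [1 / c]. Optimizing it produces the [32] and the [4] of the theorem exactly; all the slack sits
   in the mean, where [4] is weakened to [384]. A second obstacle is measurability: [rho] is an
   arbitrary map, so nothing says at first that the event on [rho_n] is measurable. This too is
   extracted from (T2), which makes [rho] Hölder continuous for [W_1] on CDFs with a common bounded
   support, hence [rho_n] a continuous function of the sample. *)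
Require Import Defs.
From HB Require Import structures.
From mathcomp Require Import all_boot all_order all_algebra.
From mathcomp Require Import all_classical all_reals all_analysis.
From mathcomp Require Import measurable_realfun.
From mathcomp Require Import zify ring lra.

Import Order.TTheory GRing.Theory Num.Theory.
Import numFieldNormedType.Exports.

Local Open Scope classical_set_scope.
Local Open Scope ring_scope.

(** * Resampling one coordinate under a product law *)

Section product_law.
Context {R : realType} {n : nat}.
Implicit Types (t : n.-tuple R) (k : 'I_n).

Definition update t k (x : R) : n.-tuple R :=
  [tuple if i == k then x else tnth t i | i < n].

Lemma tnth_update t k x i :
  tnth (update t k x) i = if i == k then x else tnth t i.
Proof. by rewrite tnth_mktuple. Qed.

Lemma measurable_update k :
  measurable_fun [set: R * n.-tuple R] (fun z => update z.2 k z.1).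
Proof.
apply/measurable_fun_tnthP => i.
have [ik|ik] := eqVneq i k.
  apply: (eq_measurable_fun fst) => [z _ /=|]; last exact: measurable_fst.
  by rewrite tnth_update ik eqxx.
apply: (eq_measurable_fun (fun z : R * n.-tuple R => tnth z.2 i)) => [z _ /=|].
  by rewrite tnth_update (negbTE ik).
exact: (measurableT_comp (measurable_tnth i) measurable_snd).
Qed.

Definition box (A : 'I_n -> set R) : set (n.-tuple R) :=
  [set t | forall i, A i (tnth t i)].

Lemma measurable_box A : (forall i, measurable (A i)) -> measurable (box A).
Proof.
move=> mA; rewrite (_ : box A =
    \bigcap_(i in [set: 'I_n]) ((fun t : n.-tuple R => tnth t i) @^-1` A i)).
  apply: fin_bigcap_measurable => // i _.
  rewrite -[X in measurable X]setTI; exact: (measurable_tnth i).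
by apply/seteqP; split => t At i; [move=> _|]; exact: At.
Qed.

(** A one-coordinate cylinder is a box whose other sides are [setT]. Boxes are preferred as
    generators because they are stable under intersection, as uniqueness of measures requires. *)
Lemma measurable_tuple_box : (@measurable _ (n.-tuple R)) =
  <<s [set box A | A in [set A | forall i, measurable (A i)]] >>.
Proof.
apply/seteqP; split; last first.
  apply: smallest_sub; first exact: sigma_algebra_measurable.
  by move=> _ [A mA <-]; exact: measurable_box.
apply: smallest_sub; first exact: smallest_sigma_algebra.
move=> B.
have : forall s : seq 'I_n, (\big[setU/set0]_(i <- s)
    preimage_set_system setT (fun t : n.-tuple R => tnth t i) measurable) B ->
    exists i, exists2 A, measurable A & (fun t : n.-tuple R => tnth t i) @^-1` A = B.
  elim=> [|i s IH]; first by rewrite big_nil.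
  rewrite big_cons => -[[A mA <-]|/IH//].
  by exists i, A => //; rewrite setTI.
move=> /(_ (index_enum _)) /[apply] -[i [A mA <-]].
apply: sub_sigma_algebra; exists (fun j => if j == i then A else setT) => [j /=|].
  by case: ifP.
apply/seteqP; split => t /=; first by move=> /(_ i); rewrite eqxx.
by move=> At j; case: eqP => // ->.
Qed.

Variables (nu : probability (n.-tuple R) R) (mu : 'I_n -> probability R R).
Hypothesis nuE : forall A, (forall i, measurable (A i)) ->
  nu (box A) = (\prod_(i < n) mu i (A i))%E.

(** Replacing coordinate [k] by an independent draw from [mu k] preserves every box probability,
    hence preserves [nu]; Tonelli then integrates the new coordinate first. This is the only form in
    which independence is used below. *)
Lemma resampling k (h : n.-tuple R -> \bar R) :
  measurable_fun [set: n.-tuple R] h -> (forall t, 0 <= h t)%E ->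
  (\int[nu]_t h t = \int[nu]_t \int[mu k]_x h (update t k x))%E.
Proof.
move=> mh h0.
pose u := fun z : R * n.-tuple R => update z.2 k z.1.
have mu_ : measurable_fun setT u by exact: measurable_update.
pose u_mixin := isMeasurableFun.Build _ _ _ _ u mu_.
pose uf : {mfun (R * n.-tuple R)%type >-> n.-tuple R} := HB.pack u u_mixin.
have nu_u A : measurable A -> nu A = pushforward (mu k \x nu)%E uf A.
  apply: (measure_unique [set box A | A in [set A | forall i, measurable (A i)]]
    (fun=> setT)).
  - exact: measurable_tuple_box.
  - move=> _ _ [B mB <-] [C mC <-]; exists (fun i => B i `&` C i) => [i|].
      exact: measurableI.
    apply/seteqP; split => t /=; last by move=> [Bt Ct] i; split.
    by move=> BCt; split => i; have [] := BCt i.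
  - by move=> _; exists (fun=> setT) => //; apply/seteqP; split.
  - by rewrite bigcup_const.
  - move=> _ [B mB <-].
    transitivity (\prod_(i < n) mu i (B i))%E; first exact: nuE.
    rewrite /= /pushforward.
    (* The old [k]-th coordinate is overwritten, so its constraint is lifted: the preimage of the
       box is the rectangle of [B k] and [box C]. *)
    pose C := fun i => if i == k then setT else B i.
    have mC i : measurable (C i) by rewrite /C; case: ifP.
    rewrite (_ : u @^-1` box B = B k `*` box C); last first.
      apply/seteqP; split => -[x t] /=.
        move=> Bt; split; first by have := Bt k; rewrite tnth_update eqxx.
        by move=> i; have := Bt i; rewrite tnth_update /C; case: eqP.
      move=> [Bx Ct] i; rewrite tnth_update /=; case: eqP => [->//|/eqP/negbTE ik].
      by have := Ct i; rewrite /C ik.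
    rewrite product_measure1E//=; last exact: measurable_box.
    have muC : mu k (C k) = 1%E by rewrite /C eqxx; exact: (probability_setT (mu k)).
    rewrite (nuE _ mC) [LHS](bigD1 k)//=; congr (_ * _)%E.
    rewrite [RHS](bigD1 k)//= muC mul1e.
    by apply: eq_bigr => i /negbTE ik; rewrite /C ik.
  - by move=> _; exact: (le_lt_trans (probability_le1 nu measurableT) (ltry _)).
rewrite (eq_measure_integral (pushforward (mu k \x nu)%E uf)); last first.
  by move=> A mA _; exact: nu_u.
rewrite ge0_integral_pushforward//= preimage_setT.
rewrite (fubini_tonelli2 (m1 := mu k) (m2 := nu) (h \o u))//.
  exact: measurableT_comp.
by move=> z; exact: h0.
Qed.
End product_law.

(** * Exponential integrals over half-lines *)

Section exponential_integrals.
Context {R : realType}.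
Local Notation leb := (@lebesgue_measure R).

Lemma expR_Ml_cvg0 (a : R) : 0 < a -> expR (- a * t) @[t --> +oo] --> (0 : R).
Proof.
move=> a0.
rewrite (_ : (fun x => expR (- a * x)) =
             (fun z => expR (- z)) \o (fun z => a * z)); last first.
  by apply: eq_fun => x; rewrite mulNr.
apply: (@cvg_comp _ _ _ _ _ _ (pinfty_nbhs R)); last exact: cvgr_expR.
exact: gt0_cvgMry.
Qed.

Lemma continuous_expRMl (a : R) : continuous (fun t : R => expR (a * t)).
Proof.
move=> z; apply: continuous_comp; last exact: continuous_expR.
by apply: continuousM => //; exact: cst_continuous.
Qed.

Lemma is_derive_expRMl (a x : R) :
  is_derive x 1 (fun t : R => expR (a * t)) (a * expR (a * x)).
Proof.
apply: DeriveDef.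
  by apply: ex_derive.
rewrite -derive1E derive1_comp// derive1E.
have /funeqP -> := @derive_expR R.
by rewrite derive1Ml// derive1_id mulr1 mulrC.
Qed.

Lemma integral_expR_itvcy (a b : R) : 0 < a ->
  (\int[leb]_(t in `[b, +oo[) (expR (- (a * t)))%:E = (expR (- (a * b)) / a)%:E)%E.
Proof.
move=> a0.
under eq_integral do rewrite -mulNr.
rewrite (@ge0_continuous_FTC2y _ _ (fun t => - a^-1 * expR (- a * t)) _ 0)//.
- by rewrite sub0e mulNr EFinN oppeK mulrC mulNr.
- by apply: continuous_subspaceT; exact: continuous_expRMl.
- rewrite -[X in _ --> X](mulr0 (- a^-1)).
  by apply: cvgM; [exact: cvg_cst | exact: expR_Ml_cvg0].
- apply/cvg_at_right_filter.
  by apply: cvgM; [exact: cvg_cst | exact: continuous_expRMl].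
- move=> x _; have dx := is_derive_expRMl (- a) x.
  rewrite derive1Ml//= derive1E derive_val.
  by rewrite mulrA mulrNN mulVf ?mul1r// gt_eqF.
Qed.

Lemma integral_expR_itvNyc (a b : R) : 0 < a ->
  (\int[leb]_(t in `]-oo, b]) (expR (a * t))%:E = (expR (a * b) / a)%:E)%E.
Proof.
move=> a0.
rewrite -[in LHS](opprK b) ge0_integration_by_substitutionNy/=; first last.
- by move=> x _; exact: expR_ge0.
- by apply: continuous_subspaceT; exact: continuous_expRMl.
under eq_integral do rewrite /= mulrN.
by rewrite integral_expR_itvcy// mulrN opprK.
Qed.
End exponential_integrals.

(** The sigma-algebra on tuples is generated by the coordinates, so openness of a preimage must be
    turned into a countable union: that of the cubes with rational centre and radius which it
    contains. *)
Lemma measurable_fun_tuple_continuous (R : realType) n (h : n.-tuple R -> R) :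
  (forall t e, 0 < e -> exists2 d, 0 < d & forall t' : n.-tuple R,
     (forall i, `|tnth t i - tnth t' i| < d) -> `|h t - h t'| < e) ->
  measurable_fun [set: n.-tuple R] h.
Proof.
move=> ch; apply: (measurability _ (RGenOInfty.measurableE R)) => //.
move=> _ [_ [x ->] <-]; rewrite setTI.
pose cube (p : {ffun 'I_n -> rat} * rat) : set (n.-tuple R) :=
  [set t | forall i, `|tnth t i - ratr (p.1 i)| < ratr p.2].
have mcube p : measurable (cube p).
  rewrite (_ : cube p = \bigcap_(i in [set: 'I_n])
      ((fun t : n.-tuple R => tnth t i) @^-1` ball (ratr (p.1 i) : R) (ratr p.2))).
    apply: fin_bigcap_measurable => // i _.
    rewrite -[X in measurable X]setTI; apply: (measurable_tnth i) => //.
    exact: measurable_ball.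
  apply/seteqP; split => t /= ct; first by move=> i _; rewrite /ball/= distrC.
  by move=> i; rewrite distrC; exact: ct.
rewrite (_ : _ @^-1` _ =
    \bigcup_p (if `[< cube p `<=` h @^-1` `]x, +oo[ >] then cube p else set0)).
  by apply: countable_bigcupT_measurable => // p; case: ifP.
apply/seteqP; split => t /=; last by move=> [p _]; case: ifP => // /asboolP; exact.
rewrite in_itv/= andbT => xht.
have /(ch t)[e e0 he] : 0 < h t - x by rewrite subr_gt0.
(* Every point of a cube of radius [r] containing [t] is within [2 r < e] of [t]. *)
have [r r0 re] : exists2 r : rat, 0 < ratr r :> R & ratr r < e / 2.
  have [r] := rat_in_itvoo (divr_gt0 e0 (ltr0n _ 2)).
  by rewrite in_itv/= => /andP[]; exists r.
have /choice[q qt] : forall i, exists q : rat, `|tnth t i - ratr q| < ratr r.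
  move=> i; have /rat_in_itvoo[q] : tnth t i - ratr r < tnth t i + ratr r by lra.
  by rewrite in_itv/= => qi; exists q; rewrite ltr_norml; lra.
exists ([ffun i => q i], r) => //.
rewrite ifT; first by move=> i; rewrite /= ffunE.
apply/asboolP => t' ct' /=; rewrite in_itv/= andbT.
have : `|h t - h t'| < h t - x.
  apply: he => i; have := ct' i; have := qt i; rewrite /= ffunE.
  rewrite !ltr_norml; lra.
by rewrite ltr_norml; lra.
Qed.

(** * Quantile coupling *)

Section cdf.
Context {R : realType}.
Implicit Types F G : CDF R.

Lemma CDF_ge0 F x : 0 <= F x.
Proof.
rewrite leNgt; apply/negP => Fx0.
have /cvgr_gt/(_ _ Fx0) FN := cumulativeNy F.
have /filter_ex[y [yx]] : \forall y \near -oo, y <= x /\ F x < F y.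
  by near=> y; split; near: y => //; exact: nbhs_ninfty_le.
by apply/negP; rewrite -leNgt (cumulative_is_nondecreasing F).
Unshelve. all: by end_near. Qed.

Lemma CDF_le1 F x : F x <= 1.
Proof.
rewrite leNgt; apply/negP => Fx1.
have /cvgr_lt/(_ _ Fx1) FN := cumulativey F.
have /filter_ex[y [yx]] : \forall y \near +oo, x <= y /\ F y < F x.
  by near=> y; split; near: y => //; apply: nbhs_pinfty_ge; rewrite num_real.
by apply/negP; rewrite -leNgt (cumulative_is_nondecreasing F).
Unshelve. all: by end_near. Qed.

Lemma measurable_CDF F : measurable_fun [set: R] F.
Proof.
by apply: nondecreasing_measurable => // x y; exact: cumulative_is_nondecreasing.
Qed.

Definition quantile F (u : R) : R := inf [set x | u <= F x].

(** The limits of [F] at both ends make the set nonempty and bounded below for [0 < u < 1]; right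
    continuity puts the infimum in the set. *)
Lemma quantile_le F u x : 0 < u < 1 -> (quantile F u <= x) = (u <= F x).
Proof.
move=> /andP[u0 u1].
have lbF : has_lbound [set x | u <= F x].
  have /cvgr_lt/(_ _ u0)/filter_ex[y Fy] := cumulativeNy F.
  exists y => z /= uz; rewrite leNgt; apply/negP => zy.
  by have := cumulative_is_nondecreasing F _ _ (ltW zy); rewrite leNgt (lt_le_trans Fy).
have F0 : [set x | u <= F x] !=set0.
  by have /cvgr_gt/(_ _ u1)/filter_ex[y Fy] := cumulativey F; exists y; exact: ltW.
apply/idP/idP => [qx|]; last by move=> ux; exact: ge_inf.
rewrite leNgt; apply/negP => Fxu.
have /cvgr_lt/(_ _ Fxu) Fu := cumulative_is_right_continuous F x.
have /filter_ex[y [xy Fyu]] : \forall y \near x^'+, x < y /\ F y < u.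
  by near=> y; split; near: y => //; exact: nbhs_right_gt.
have : y <= quantile F u.
  apply: lb_le_inf => // z /= uz; rewrite leNgt; apply/negP => zy.
  by have := cumulative_is_nondecreasing F _ _ (ltW zy); rewrite leNgt (lt_le_trans Fyu).
by rewrite leNgt (le_lt_trans qx xy).
Unshelve. all: by end_near. Qed.

(** Outside the open unit interval the set defining [quantile] may be empty or unbounded; the value
    0 there gives a total measurable function, and the uniform law does not see the difference. *)
Definition quantile01 F (u : R) : R := if 0 < u < 1 then quantile F u else 0.

Lemma measurable_quantile01 F : measurable_fun [set: R] (quantile01 F).
Proof.
apply: (measurability _ (RGenOInfty.measurableE R)) => //.
move=> _ [_ [x ->] <-]; rewrite setTI.
rewrite (_ : _ @^-1` _ = (`]0, 1[ `&` `]F x, +oo[) `|`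
    (if x < 0 then ~` `]0, 1[ else set0)).
  by apply: measurableU; [exact: measurableI|case: ifP => // _; exact: measurableC].
apply/seteqP; split => u /=; rewrite /quantile01 !in_itv/= !andbT.
  case: ifPn => [u01|u01 x0].
    by rewrite ltNge quantile_le// -ltNge; left.
  by right; rewrite x0 /= in_itv/=; exact/negP.
move=> [[u01 Fxu]|]; first by rewrite u01 ltNge quantile_le// -ltNge.
by case: ifP => //= x0; rewrite in_itv/= => /negP/negbTE ->.
Qed.

Local Notation U01 := (uniform_prob (@ltr01 R)).
Local Notation leb := (@lebesgue_measure R).

Lemma integral_uniform01 (f : R -> \bar R) :
  measurable_fun [set: R] f -> (forall x, 0 <= f x)%E ->
  (\int[U01]_x f x = \int[leb]_(x in `]0%R, 1%R[) f x)%E.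
Proof.
move=> mf f0; rewrite integral_uniform// subr0 invr1 mul1e.
by rewrite integral_itv_bndoo//; exact: measurable_funTS.
Qed.

(** Inverse transform sampling: by [quantile_le] the event is [0 < u <= F x]. *)
Lemma uniform_quantile01 F x :
  U01 [set u | quantile01 F u <= x] = (F x)%:E.
Proof.
have mq : measurable [set u | quantile01 F u <= x].
  rewrite -[X in measurable X]setTI.
  rewrite (_ : [set u | _] = quantile01 F @^-1` `]-oo, x]); last first.
    by apply/seteqP; split => u /=; rewrite in_itv.
  by apply: measurable_quantile01.
transitivity (U01 ([set u | quantile01 F u <= x] `&` setT)); first by rewrite setIT.
rewrite -integral_indic// integral_uniform01//; last first.
  exact/measurable_EFinP/measurable_indic.
transitivity (\int[leb]_(u in `]0%R, 1%R[) (\1_(`]0, F x]%classic : set R) u)%:E)%E.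
  apply: eq_integral => u; rewrite inE/= in_itv/= => u01.
  rewrite !indicE; do 3 congr (_ _); apply/idP/idP; rewrite !inE/= /quantile01 u01 quantile_le//.
    by rewrite in_itv/= => ->; case/andP: u01 => ->.
  by rewrite in_itv/= => /andP[].
(* Back to the closed unit interval, so that the intersection is []0, F x]] even when [F x = 1]. *)
rewrite -(@integral_itv_bndoo _ _ _ _ true false); last first.
  exact/measurable_funTS/measurable_EFinP/measurable_indic.
rewrite integral_indic//=.
rewrite (_ : _ `&` _ = `]0, F x]%classic).
  rewrite lebesgue_measure_itv/= lte_fin.
  have := CDF_ge0 F x; rewrite le_eqVlt => /predU1P[<-|->]; first by rewrite ltxx.
  by rewrite sube0.
apply/seteqP; split => u /=; rewrite !in_itv/=; first by case.
move=> /andP[u0 uF]; rewrite u0 uF (ltW u0) (le_trans uF)//; exact: CDF_le1.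
Qed.

(** The endpoint flags are left free because the region between two graphs has vertical slices
    closed on the right and horizontal slices closed on the left. *)
Lemma integral_indic_between b0 b1 (x y : R) :
  (\int[leb]_t (\1_([set` Interval (BSide b0 (Num.min x y))
     (BSide b1 (Num.max x y))] : set R) t)%:E = `|x - y|%:E)%E.
Proof.
rewrite integral_indic//= setIT lebesgue_measure_itv/= lte_fin.
case: (ltgtP x y) => xy; rewrite ?ltxx.
- by rewrite xy distrC gtr0_norm ?subr_gt0// EFinB.
- by rewrite xy gtr0_norm ?subr_gt0// EFinB.
- by rewrite xy subrr normr0.
Qed.

(** Both sides say that [(t, u)] lies between the graphs of [F] and [G], once read along [t] and
    once along [u]. *)
Lemma quantile_between F G u t : 0 < u < 1 ->
  (Num.min (quantile F u) (quantile G u) <= t <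
     Num.max (quantile F u) (quantile G u)) =
  (Num.min (F t) (G t) < u <= Num.max (F t) (G t)).
Proof.
move=> u01; rewrite ge_min lt_max gt_min le_max !ltNge !quantile_le//.
by case: (u <= F t); case: (u <= G t).
Qed.

(** Feeding one uniform variable to both quantile functions gives a coupling. Its cost is the area
    between the quantile graphs, which is the area between the graphs of [F] and [G], by Tonelli. No
    finiteness is assumed. *)
Lemma wasserstein1_le F G :
  (wasserstein1 F G <= \int[leb]_t `|F t - G t|%:E)%E.
Proof.
pose q (u : measurableTypeR R) : R * R := (quantile01 F u, quantile01 G u).
have mq : measurable_fun setT q.
  by apply: measurable_fun_pair; exact: measurable_quantile01.
pose q_mixin := isMeasurableFun.Build _ _ _ _ q mq.
pose qf : {mfun measurableTypeR R >-> (R * R)%type} := HB.pack q q_mixin.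
pose pi : probability (R * R)%type R := distribution U01 qf.
have cpi : is_coupling F G pi.
  by split => x; rewrite -uniform_quantile01.
apply: (@le_trans _ _ (\int[pi]_z `|z.1 - z.2|%:E)%E).
  by apply: ereal_inf_lbound; exists pi.
have md : measurable_fun [set: R * R] (fun z : R * R => `|z.1 - z.2|%:E).
  apply/measurable_EFinP/measurableT_comp => //.
  by apply: measurable_funB; [exact: measurable_fst|exact: measurable_snd].
rewrite ge0_integral_distribution//.
have mqd : measurable_fun [set: R] ((fun z : R * R => `|z.1 - z.2|%:E) \o q).
  exact: (measurableT_comp md mq).
rewrite integral_uniform01//; last by move=> x; rewrite lee_fin.
(* Indicator of the region between the graphs, height first and abscissa second. *)
pose k (z : R * R) : \bar R :=
  (((Num.min (F z.2) (G z.2) < z.1) && (z.1 <= Num.max (F z.2) (G z.2)))%:R)%:E.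
have k0 z : (0 <= k z)%E by rewrite lee_fin.
have mk : measurable_fun setT k.
  have m1 : measurable_fun [set: R * R] (fun z => Num.min (F z.2) (G z.2)).
    by apply: measurable_minr; exact: (measurableT_comp (measurable_CDF _) measurable_snd).
  have m2 : measurable_fun [set: R * R] (fun z => Num.max (F z.2) (G z.2)).
    by apply: measurable_maxr; exact: (measurableT_comp (measurable_CDF _) measurable_snd).
  have m3 : measurable_fun [set: R * R] (fun z =>
     (Num.min (F z.2) (G z.2) < z.1) && (z.1 <= Num.max (F z.2) (G z.2))).
    apply: measurable_and; first exact: measurable_fun_ltr m1 measurable_fst.
    exact: measurable_fun_ler measurable_fst m2.
  apply/measurable_EFinP.
  rewrite (_ : (fun z => _) = fun z => if (Num.min (F z.2) (G z.2) < z.1) &&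
     (z.1 <= Num.max (F z.2) (G z.2)) then 1 else 0).
    by apply: measurable_fun_ifT.
  by apply/funext => z; case: ifP.
have kt t : (\int[leb]_u k (u, t) = `|F t - G t|%:E)%E.
  rewrite -(integral_indic_between false false).
  by apply: eq_integral => u _; rewrite indicE /k/= mem_setE in_itv.
have fub : (\int[leb]_u \int[leb]_t k (u, t) = \int[leb]_t \int[leb]_u k (u, t))%E.
  exact: (fubini_tonelli (m1 := leb) (m2 := leb) k).
under [leRHS]eq_integral do rewrite -kt.
rewrite -fub.
have mK : measurable_fun [set: measurableTypeR R] (fun u => \int[leb]_t k (u, t))%E.
  exact: (measurable_fun_fubini_tonelli_F (m2 := leb) k).
have K0 (u : measurableTypeR R) : setT u -> (0 <= \int[leb]_t k (u, t))%E.
  by move=> _; apply: integral_ge0 => t _; exact: k0.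
have mI : measurable (`]0%R, 1%R[%classic : set (measurableTypeR R)).
  exact: measurable_itv.
(* An upper bound suffices, so [u] may range over the whole line instead of the unit interval. *)
apply: le_trans (ge0_subset_integral leb mI measurableT mK K0 (@subsetT _ _)).
rewrite le_eqVlt; apply/orP; left; apply/eqP.
apply: eq_integral => u; rewrite inE/= in_itv/= => u01.
rewrite /q /quantile01 u01 -(integral_indic_between true true).
apply: eq_integral => t _; rewrite indicE /k/= mem_setE in_itv/=.
by rewrite quantile_between.
Qed.
End cdf.

(** * Exponential moments *)

Section cosh.
Context {R : realType}.
Local Notation leb := (@lebesgue_measure R).

Definition cosh (y : R) : R := (expR y + expR (- y)) / 2.

Lemma cosh_ge0 y : 0 <= cosh y.
Proof. by rewrite divr_ge0// addr_ge0// expR_ge0. Qed.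

Lemma coshN y : cosh (- y) = cosh y.
Proof. by rewrite /cosh opprK addrC. Qed.

Lemma cosh_norm y : cosh `|y| = cosh y.
Proof. by case: (ger0P y) => // _; rewrite coshN. Qed.

Lemma le_cosh u v : `|u| <= `|v| -> cosh u <= cosh v.
Proof.
rewrite -(cosh_norm u) -(cosh_norm v) => uv.
have mono (a b : R) : 0 <= a -> a <= b -> cosh a <= cosh b.
  move=> a0 ab; rewrite /cosh ler_pM2r ?invr_gt0// -subr_ge0.
  (* This product equals [2 * (cosh b - cosh a)]. *)
  have : 0 <= (expR b - expR a) * (1 - expR (- a) * expR (- b)).
    rewrite mulr_ge0// subr_ge0 ?ler_expR//.
    by rewrite -expRD -[leRHS]expR0 ler_expR -opprD oppr_le0 addr_ge0// (le_trans a0).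
  rewrite (_ : _ * _ = expR b - expR a - expR (- a) * (expR b * expR (- b)) +
      expR a * expR (- a) * expR (- b)); last by ring.
  by rewrite !expRxMexpNx_1 mulr1 mul1r; lra.
exact: mono.
Qed.

(** Midpoint convexity between [2 p] and [- 2 q], with evenness. It decouples the two arguments, at
    the price of the factor 2 that later forces [2 lambda K < c]. *)
Lemma cosh_sub_le p q : 2 * cosh (p - q) <= cosh (2 * p) + cosh (2 * q).
Proof.
rewrite /cosh opprB !expRD.
have e2 (z : R) : expR (2 * z) = expR z ^+ 2 by rewrite mulrC expRM_natr.
rewrite -!mulrN !e2.
have := sqr_ge0 (expR p - expR (- q)); have := sqr_ge0 (expR (- p) - expR q).
rewrite !sqrrB; lra.
Qed.

Lemma measurable_cosh : measurable_fun [set: R] cosh.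
Proof.
apply: measurable_funM => //; apply: measurable_funD => //.
exact: measurableT_comp.
Qed.

Variables (mu : probability R R) (c : R).
Hypothesis c_gt0 : 0 < c.
Hypothesis mu_right : forall e, 0 <= e ->
  (mu [set x | (e < x)%R] <= (expR (- (c * e)))%:E)%E.
Hypothesis mu_left : forall e, 0 <= e ->
  (mu [set x | (x <= - e)%R] <= (expR (- (c * e)))%:E)%E.

Lemma tail_norm_le e : 0 <= e ->
  (mu [set x | (e < `|x|)%R] <= (2 * expR (- (c * e)))%:E)%E.
Proof.
move=> e0.
have m1 : measurable [set x : R | e < x] by rewrite -set_itvoy.
have m2 : measurable [set x : R | x <= - e] by rewrite -set_itvNyc.
apply: (@le_trans _ _ (mu ([set x | (e < x)%R] `|` [set x | (x <= - e)%R]))%E).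
  apply: le_measure; rewrite ?inE.
  - rewrite (_ : [set x | _] = [set x | e < x] `|` [set x | x < - e]).
      by apply: measurableU => //; rewrite -set_itvNyo.
    by apply/seteqP; split => x /=; rewrite lter_normr ltrNr => /orP.
  - exact: measurableU.
  - by move=> x /=; rewrite lter_normr ltrNr => /orP[]; [left|right; exact: ltW].
apply: le_trans (measureU2 _ m1 m2) _.
by rewrite mulr2n mulrDl mul1r EFinD leeD// ?mu_right// mu_left.
Qed.

(** The derivative of [cosh (th * t)] in [t]. *)
Let psi (th t : R) := th * (expR (th * t) - expR (- th * t)) / 2.

Let psi_ge0 (th t : R) : 0 <= th -> 0 <= t -> 0 <= psi th t.
Proof.
move=> th0 t0; rewrite divr_ge0// mulr_ge0// subr_ge0 ler_expR.
by have := mulr_ge0 th0 t0; lra.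
Qed.

Let continuous_psi th : continuous (psi th).
Proof.
move=> t; apply: cvgM; last exact: cvg_cst.
apply: cvgM; first exact: cvg_cst.
by apply: cvgB; exact: continuous_expRMl.
Qed.

Let integral_psi (th y : R) : 0 <= y ->
  (\int[leb]_(t in `[0%R, y]) (psi th t)%:E = (cosh (th * y) - 1)%:E)%E.
Proof.
rewrite le_eqVlt => /predU1P[<-|y0].
  rewrite set_itv1 integral_set1 mulr0 /cosh oppr0 expR0; congr EFin; lra.
have dF (x : R) : is_derive x 1 (fun t => cosh (th * t)) (psi th x).
  rewrite (_ : (fun t => _) =
      (fun t => 2^-1 * (expR (th * t) + expR (- th * t)))); last first.
    by apply/funext => t; rewrite /cosh mulrC mulNr.
  have d1 := is_derive_expRMl th x.
  have d2 := is_derive_expRMl (- th) x.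
  apply: is_derive_eq.
  rewrite /psi /GRing.scale/=; lra.
have cF : continuous (fun t => cosh (th * t)).
  move=> x; apply: differentiable_continuous.
  by apply/derivable1_diffP; apply: ex_derive.
rewrite (@continuous_FTC2 _ _ (fun t => cosh (th * t)))//.
- by rewrite -EFinB mulr0 {2}/cosh oppr0 expR0; congr EFin; lra.
- by apply: continuous_subspaceT; exact: continuous_psi.
- split.
  + by move=> x _; apply: ex_derive.
  + by apply: cvg_at_right_filter; exact: cF.
  + by apply: cvg_at_left_filter; exact: cF.
- by move=> x _; rewrite derive1E derive_val.
Qed.

Let integral_psi_exp (th : R) : 0 < th < c ->
  (\int[leb]_(t in `[0%R, +oo[) (psi th t * (2 * expR (- (c * t))))%:E =
   (2 * th ^+ 2 / (c ^+ 2 - th ^+ 2))%:E)%E.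
Proof.
move=> /andP[th0 thc].
have cth : 0 < c - th by rewrite subr_gt0.
have cth' : 0 < c + th by rewrite addr_gt0.
have mE a : measurable_fun (`[0, +oo[ : set R) (fun t => (expR (- (a * t)))%:E).
  apply/measurable_funTS/measurable_EFinP.
  apply: (measurableT_comp (@measurable_expR R)); apply: measurable_funN.
  exact: measurable_funM.
have mpsi : measurable_fun (`[0, +oo[ : set R)
    (fun t => (psi th t * (2 * expR (- (c * t))))%:E).
  apply/measurable_funTS/measurable_EFinP/measurable_funM.
    exact: (continuous_measurable_fun (@continuous_psi th)).
  apply: measurable_funM => //.
  apply: (measurableT_comp (@measurable_expR R)); apply: measurable_funN.
  exact: measurable_funM.
have mE' a : measurable_fun (`[0, +oo[ : set R) (fun t => (th * expR (- (a * t)))%:E).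
  apply/measurable_funTS/measurable_EFinP/measurable_funM => //.
  apply: (measurableT_comp (@measurable_expR R)); apply: measurable_funN.
  exact: measurable_funM.
have intE a : (\int[leb]_(t in `[0%R, +oo[) (th * expR (- (a * t)))%:E =
    th%:E * \int[leb]_(t in `[0%R, +oo[) (expR (- (a * t)))%:E)%E.
  under eq_integral do rewrite EFinM.
  rewrite ge0_integralZl//; last by rewrite lee_fin ltW.
  exact: mE.
(* The integrand is [th * (exp (- (c - th) t) - exp (- (c + th) t))]; the subtracted term is moved
   to the left so that only integrals of nonnegative functions are added. *)
have : (\int[leb]_(t in `[0%R, +oo[) (psi th t * (2 * expR (- (c * t))))%:E
    + \int[leb]_(t in `[0%R, +oo[) (th * expR (- ((c + th) * t)))%:E
    = \int[leb]_(t in `[0%R, +oo[) (th * expR (- ((c - th) * t)))%:E)%E.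
  rewrite -ge0_integralD//=.
  - apply: eq_integral => t _.
    rewrite -EFinD; congr EFin.
    rewrite (_ : - ((c + th) * t) = - (c * t) + - th * t); last by ring.
    rewrite (_ : - ((c - th) * t) = - (c * t) + th * t); last by ring.
    rewrite !expRD /psi; lra.
  - move=> t; rewrite in_itv/= andbT => t0.
    by rewrite lee_fin mulr_ge0 ?psi_ge0 ?(ltW th0)// mulr_ge0// expR_ge0.
  - by move=> t _; rewrite lee_fin mulr_ge0 ?(ltW th0)// expR_ge0.
  - exact: mE'.
rewrite !intE.
rewrite !integral_expR_itvcy// !mulr0 oppr0 expR0 -!EFinM => E.
have := E => /(congr1 (fun z => z - (th * (1 / (c + th)))%:E)%E).
rewrite addeK// => ->; rewrite -EFinB; congr EFin.
field; rewrite subr_sqr mulf_neq0 ?gt_eqF//=.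
Qed.

(** Layer cake: [cosh (th x) - 1] is the integral of [psi th] over [[0, |x|]], so by Tonelli its
    mean is the integral of [psi th t] against [mu (|x| > t) <= 2 exp (- c t)], finite because
    [th < c]. *)
Lemma integral_cosh_le (th : R) : 0 < th < c ->
  (\int[mu]_x (cosh (th * x))%:E <=
   (1 + 2 * th ^+ 2 / (c ^+ 2 - th ^+ 2))%:E)%E.
Proof.
move=> /[dup] thc /andP[th0 _].
pose k (z : R * R) : \bar R :=
  (psi th z.2 * ((0 <= z.2) && (z.2 < `|z.1|))%:R)%:E.
have k0 z : (0 <= k z)%E.
  rewrite lee_fin; case: (leP 0 z.2) => z0; last by rewrite mulr0.
  by rewrite mulr_ge0// psi_ge0// ltW.
have mk : measurable_fun setT k.
  apply/measurable_EFinP/measurable_funM.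
    apply: (measurableT_comp (continuous_measurable_fun (@continuous_psi th))).
    exact: measurable_snd.
  have m3 : measurable_fun [set: R * R] (fun z => (0 <= z.2) && (z.2 < `|z.1|)).
    apply: measurable_and; first exact: measurable_fun_ler _ measurable_snd.
    apply: measurable_fun_ltr; first exact: measurable_snd.
    exact: measurableT_comp measurable_fst.
  rewrite (_ : (fun z => _) = fun z => if (0 <= z.2) && (z.2 < `|z.1|) then 1 else 0).
    by apply: measurable_fun_ifT.
  by apply/funext => z; case: ifP.
have kx x : (\int[leb]_t k (x, t) = (cosh (th * x) - 1)%:E)%E.
  rewrite -(cosh_norm (th * x)) normrM (gtr0_norm th0) -integral_psi//.
  rewrite -integral_itv_bndo_bndc; last first.
    apply/measurable_funTS/measurable_EFinP.
    exact: (continuous_measurable_fun (@continuous_psi th)).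
  rewrite [RHS]integral_mkcond; apply: eq_integral => t _.
  rewrite patchE mem_setE in_itv/= /k/=.
  by case: ifP; rewrite ?mulr1 ?mulr0.
have -> : (\int[mu]_x (cosh (th * x))%:E = \int[mu]_x (1 + \int[leb]_t k (x, t)))%E.
  apply: eq_integral => x _; rewrite kx -EFinD; congr EFin; ring.
rewrite ge0_integralD//; last 2 first.
  by move=> x _; exact: integral_ge0.
  exact: measurable_fun_fubini_tonelli_F.
rewrite integral_cst// mul1e EFinD leeD ?probability_le1//.
have -> : (\int[mu]_x \int[leb]_t k (x, t) = \int[leb]_t \int[mu]_x k (x, t))%E.
  exact: (fubini_tonelli (m1 := mu) (m2 := leb) k).
rewrite -(integral_psi_exp _ thc) [leRHS]integral_mkcond.
have me : measurable_fun [set: R] (fun t => (psi th t * (2 * expR (- (c * t))))%:E).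
  apply/measurable_EFinP/measurable_funM.
    exact: (continuous_measurable_fun (@continuous_psi th)).
  apply: measurable_funM => //.
  apply: (measurableT_comp (@measurable_expR R)); apply: measurable_funN.
  exact: measurable_funM.
apply: ge0_le_integral => //.
- by move=> t _; exact: integral_ge0.
- exact: measurable_fun_fubini_tonelli_G.
- by apply/(measurable_restrictT _ _).1 => //; exact: measurable_funTS.
move=> t _; rewrite patchE mem_setE in_itv/= andbT /k/=.
case: (leP 0%R t) => t0; last by rewrite integral0_eq// => x _; rewrite mulr0.
have mt : measurable [set x : R | t < `|x|].
  rewrite -[X in measurable X]setTI.
  have := measurable_fun_ltr (measurable_cst t) (@normr_measurable R setT).
  by move=> /(_ measurableT [set true]); rewrite /preimage/=; apply.
have -> : (\int[mu]_x (psi th t * (t < `|x|)%R%:R)%:E =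
    \int[mu]_x ((psi th t)%:E * (\1_[set x : R | t < `|x|] x)%:E))%E.
  apply: eq_integral => x _; rewrite -EFinM indicE.
  by have -> : (x \in [set x : R | t < `|x|]) = (t < `|x|)%R by apply/idP/idP; rewrite inE.
rewrite ge0_integralZl//; last 2 first.
- by apply/measurable_EFinP; exact: measurable_indic.
- by rewrite lee_fin psi_ge0// ltW.
rewrite integral_indic// setIT [leRHS]EFinM lee_wpmul2l//; last exact: tail_norm_le.
by rewrite lee_fin psi_ge0// ltW.
Qed.
End cosh.

Lemma lipschitz_measurable (R : realType) n (P : pred 'I_n) (K : R)
    (g : n.-tuple R -> R) : 0 <= K ->
  (forall t t', `|g t - g t'| <= K * \sum_(i | P i) `|tnth t i - tnth t' i|) ->
  measurable_fun [set: n.-tuple R] g.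
Proof.
move=> K0 gK; apply: measurable_fun_tuple_continuous => t e e0.
have Kn : 0 < K * n%:R + 1 by rewrite ltr_wpDl// mulr_ge0.
(* The sum has at most [n] terms; the [+ 1] keeps the denominator positive when [K] or [n] is 0. *)
exists (e / (K * n%:R + 1)) => [|t' tt']; first exact: divr_gt0.
apply: (le_lt_trans (gK t t')).
apply: (@le_lt_trans _ _ (K * (n%:R * (e / (K * n%:R + 1))))).
  rewrite ler_wpM2l//.
  apply: (@le_trans _ _ (\sum_(i < n) (e / (K * n%:R + 1)))).
    rewrite big_mkcond; apply: ler_sum => i _.
    by case: ifP => _; [exact: ltW|rewrite ltW// divr_gt0].
  by rewrite sumr_const card_ord mulr_natl.
rewrite [ltLHS]mulrA [ltLHS]mulrCA -[ltRHS]mulr1 ltr_pM2l//.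
by rewrite ltr_pdivrMr// mul1r ltrDl.
Qed.

(** * Laplace transform of a Lipschitz function of one variable *)

Section one_variable.
Context {R : realType} (mu : probability R R).
Variables (lambda K C : R).
Hypotheses (lambda_gt0 : 0 < lambda) (K_ge0 : 0 <= K).
Hypothesis muC : (\int[mu]_x (cosh (2 * (lambda * K) * x))%:E <= C%:E)%E.

Variable g : R -> R.
Hypothesis mg : measurable_fun [set: R] g.
Hypothesis g_ge0 : forall x, 0 <= g x.
Hypothesis gK : forall x y, `|g x - g y| <= K * `|x - y|.

Let mexp a : measurable_fun [set: R] (fun x => (expR (a * g x))%:E).
Proof.
apply/measurable_EFinP/(measurableT_comp (@measurable_expR R)).
exact: measurable_funM.
Qed.

(** With [A] and [B] the Laplace transforms of [g] at [lambda] and [- lambda], [2 A B] is the mean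
    of [2 cosh (lambda (g x - g y))] over independent [x], [y], hence at most [2 C]; Jensen gives
    [B >= exp (- lambda m)]. Finiteness of the mean and of [A] is part of the conclusion, not
    assumed. *)
Lemma lipschitz_laplace_le : exists m,
  (\int[mu]_x (g x)%:E = m%:E)%E /\
  (\int[mu]_x (expR (lambda * g x))%:E <= (expR (lambda * m) * C)%:E)%E.
Proof.
set th := 2 * (lambda * K).
set S := (\int[mu]_x (cosh (th * x))%:E)%E.
set A := (\int[mu]_x (expR (lambda * g x))%:E)%E.
set B := (\int[mu]_x (expR (- lambda * g x))%:E)%E.
have A0 : (0 <= A)%E by apply: integral_ge0 => x _; rewrite lee_fin expR_ge0.
have B0 : (0 <= B)%E by apply: integral_ge0 => x _; rewrite lee_fin expR_ge0.
have S0 : (0 <= S)%E by apply: integral_ge0 => x _; rewrite lee_fin cosh_ge0.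
have Sfin : S \is a fin_num by rewrite ge0_fin_numE// (le_lt_trans muC) ?ltry.
have mcosh : measurable_fun [set: R] (fun x => (cosh (th * x))%:E).
  apply/measurable_EFinP/(measurableT_comp (@measurable_cosh R)).
  exact: measurable_funM.
have pointwise x y :
    expR (lambda * g x) * expR (- lambda * g y) +
    expR (- lambda * g x) * expR (lambda * g y) <=
    cosh (th * x) + cosh (th * y).
  rewrite -!expRD.
  have -> : - lambda * g x + lambda * g y = - (lambda * g x + - lambda * g y) by ring.
  have -> : th * x = 2 * (lambda * K * x) by rewrite /th; ring.
  have -> : th * y = 2 * (lambda * K * y) by rewrite /th; ring.
  apply: le_trans (cosh_sub_le _ _).
  have -> (u : R) : expR u + expR (- u) = 2 * cosh u.
    by rewrite /cosh mulrCA mulfV ?mulr1.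
  rewrite ler_pM2l//; apply: le_cosh.
  rewrite mulNr -!mulrBr !normrM (gtr0_norm lambda_gt0) (ger0_norm K_ge0).
  by rewrite -mulrA ler_pM2l.
(* Integrating in [y] alone, with [x] fixed, already bounds positive multiples of [A] and [B] by a
   finite number; this is where their finiteness comes from. *)
have half x : ((expR (lambda * g x))%:E * B + (expR (- lambda * g x))%:E * A <=
    (cosh (th * x))%:E + S)%E.
  have e0 a y : (0 <= (expR (a * g y))%:E)%E by rewrite lee_fin expR_ge0.
  have mx a b : measurable_fun [set: R]
      (fun y => ((expR (a * g x))%:E * (expR (b * g y))%:E)%E).
    by apply: emeasurable_funM => //; exact: mexp.
  rewrite -!ge0_integralZl//; [|exact: mexp..].
  rewrite -ge0_integralD//; [|by move=> y _; rewrite mule_ge0..].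
  have -> : ((cosh (th * x))%:E + S =
      \int[mu]_y ((cosh (th * x))%:E + (cosh (th * y))%:E))%E.
    rewrite ge0_integralD//; last 2 first.
    - by move=> y _; rewrite lee_fin cosh_ge0.
    - by move=> y _; rewrite lee_fin cosh_ge0.
    by rewrite integral_cst// [X in (_ * X)%E](probability_setT mu) mule1.
  apply: ge0_le_integral => //.
  - by move=> y _; rewrite adde_ge0// mule_ge0.
  - by apply: emeasurable_funD; exact: mx.
  - exact: emeasurable_funD.
  - by move=> y _; rewrite -!EFinM -!EFinD lee_fin pointwise.
have AE : (\int[mu]_x (expR (lambda * g x))%:E = A)%E by [].
have BE : (\int[mu]_x (expR (- lambda * g x))%:E = B)%E by [].
have SE : (\int[mu]_x (cosh (th * x))%:E = S)%E by [].
clearbody A B S.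
have fin x : ((expR (- lambda * g x))%:E * A)%E \is a fin_num /\
    ((expR (lambda * g x))%:E * B)%E \is a fin_num.
  have a0 : (0 <= (expR (- lambda * g x))%:E * A)%E.
    by rewrite mule_ge0// lee_fin expR_ge0.
  have b0 : (0 <= (expR (lambda * g x))%:E * B)%E.
    by rewrite mule_ge0// lee_fin expR_ge0.
  have Sx : ((cosh (th * x))%:E + S < +oo)%E by rewrite -(fineK Sfin) -EFinD ltry.
  rewrite !ge0_fin_numE//; split; apply: le_lt_trans Sx; apply: le_trans (half x).
    exact: leeDr.
  exact: leeDl.
have Afin : A \is a fin_num.
  have [+ _] := fin 0; rewrite ge0_fin_numE ?mule_ge0 ?lee_fin ?expR_ge0//.
  rewrite ge0_fin_numE// !ltey; apply: contra => /eqP ->.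
  by rewrite mulry gtr0_sg ?expR_gt0// mul1e.
have Bfin : B \is a fin_num.
  have [_] := fin 0; rewrite ge0_fin_numE ?mule_ge0 ?lee_fin ?expR_ge0//.
  rewrite ge0_fin_numE// !ltey; apply: contra => /eqP ->.
  by rewrite mulry gtr0_sg ?expR_gt0// mul1e.
(* The second integration, now in [x]: iterated integrals replace the product measure. *)
have AB : (A * B + A * B <= S + S)%E.
  have mAB : (\int[mu]_x ((expR (lambda * g x))%:E * B + (expR (- lambda * g x))%:E * A)
      = A * B + A * B)%E.
    rewrite -{1}(fineK Bfin) -{1}(fineK Afin) ge0_integralD//.
    - rewrite !ge0_integralZr//; try solve [exact: mexp
        | by move=> y _; rewrite lee_fin expR_ge0 | by rewrite lee_fin fine_ge0].
      by rewrite AE BE !fineK// [(B * A)%E]muleC.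
    - by move=> y _; rewrite -EFinM lee_fin mulr_ge0 ?expR_ge0 ?fine_ge0.
    - by apply: emeasurable_funM => //; exact: mexp.
    - by move=> y _; rewrite -EFinM lee_fin mulr_ge0 ?expR_ge0 ?fine_ge0.
    - by apply: emeasurable_funM => //; exact: mexp.
  have mS : (\int[mu]_x ((cosh (th * x))%:E + S) = S + S)%E.
    rewrite -{1}(fineK Sfin) ge0_integralD//.
    - by rewrite integral_cst// [X in (_ * X)%E](probability_setT mu) mule1 fineK// SE.
    - by move=> y _; rewrite lee_fin cosh_ge0.
    - by move=> y _; rewrite lee_fin fine_ge0.
  rewrite -mAB -mS; apply: ge0_le_integral => //.
  - by move=> x _; rewrite adde_ge0// mule_ge0// lee_fin expR_ge0.
  - rewrite -(fineK Bfin) -(fineK Afin).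
    by apply: emeasurable_funD; apply: emeasurable_funM => //; exact: mexp.
  - by rewrite -(fineK Sfin); apply: emeasurable_funD.
have mgE : measurable_fun [set: R] (fun x => (g x)%:E) by exact/measurable_EFinP.
(* From [lambda g <= exp (lambda g)]: the mean of [g] is finite. *)
have gA : (\int[mu]_x (g x)%:E <= (lambda^-1)%:E * A)%E.
  rewrite -AE -ge0_integralZl//; last by rewrite lee_fin invr_ge0 ltW.
  apply: ge0_le_integral => //.
  - by move=> x _; rewrite lee_fin.
  - by apply: emeasurable_funM => //; exact: mexp.
  - move=> x _; rewrite -EFinM lee_fin mulrC ler_pdivlMr// mulrC.
    by apply: le_trans (expR_ge1Dx _); rewrite lerDr.
have gfin : (\int[mu]_x (g x)%:E)%E \is a fin_num.
  rewrite ge0_fin_numE; last by apply: integral_ge0 => x _; rewrite lee_fin.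
  by apply: le_lt_trans gA _; rewrite -(fineK Afin) -EFinM ltry.
exists (fine (\int[mu]_x (g x)%:E)%E); split; first by rewrite fineK.
set m := fine _.
(* Jensen, by integrating the tangent inequality [1 + v <= exp v] at [v = lambda m - lambda g x],
   with [lambda g x] moved to the right to keep both integrands nonnegative. *)
have Bm : expR (- (lambda * m)) <= fine B.
  have : (\int[mu]_x (1 + lambda * m)%:E <=
      \int[mu]_x ((expR (lambda * m) * expR (- lambda * g x))%:E + (lambda * g x)%:E))%E.
    apply: ge0_le_integral => //.
    - move=> x _; rewrite lee_fin addr_ge0// mulr_ge0 ?(ltW lambda_gt0)//.
      by apply: fine_ge0; apply: integral_ge0 => y _; rewrite lee_fin.
    - apply: emeasurable_funD; apply/measurable_EFinP; apply: measurable_funM => //.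
      by apply: measurableT_comp => //; exact: measurable_funM.
    - move=> x _; rewrite -EFinD lee_fin -expRD.
      by have := expR_ge1Dx (lambda * m + - lambda * g x); lra.
  have me : measurable_fun [set: R]
      (fun x => (expR (lambda * m) * expR (- lambda * g x))%:E).
    apply/measurable_EFinP; apply: measurable_funM => //.
    by apply: measurableT_comp => //; exact: measurable_funM.
  have ml : measurable_fun [set: R] (fun x => (lambda * g x)%:E).
    by apply/measurable_EFinP; exact: measurable_funM.
  rewrite integral_cst// [X in (_ * X)%E](probability_setT mu) mule1.
  rewrite ge0_integralD//; last by move=> x _; rewrite lee_fin mulr_ge0// ltW.
  under eq_integral do rewrite EFinM.
  rewrite ge0_integralZl//.
  under [X in (_ + X)%E]eq_integral do rewrite EFinM.
  rewrite ge0_integralZl//; [|by move=> x _; rewrite lee_fin|by rewrite lee_fin ltW].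
  rewrite BE -(fineK gfin) -/m -(fineK Bfin) -!EFinM -!EFinD lee_fin lerD2r.
  by rewrite expRN -ler_pdivrMl ?expR_gt0// mulr1.
rewrite -(fineK Afin) lee_fin.
have : fine A * fine B <= C.
  have : fine A * fine B + fine A * fine B <= fine S + fine S.
    by move: AB; rewrite -(fineK Afin) -(fineK Bfin) -(fineK Sfin) -!EFinM -!EFinD lee_fin.
  have : fine S <= C by rewrite -lee_fin fineK// -SE.
  lra.
move=> ABC.
have {}ABC : fine A * expR (- (lambda * m)) <= C.
  by apply: le_trans ABC; rewrite ler_wpM2l// fine_ge0.
rewrite -[leLHS]mul1r -(expRxMexpNx_1 (lambda * m)) -mulrA ler_pM2l ?expR_gt0//.
by rewrite mulrC.
Qed.
End one_variable.

Lemma measurable_update_section (R : realType) n (t : n.-tuple R) i :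
  measurable_fun [set: R] (update t i).
Proof.
exact: (measurableT_comp (measurable_update i) (pair2_measurable t)).
Qed.

(** * Laplace transform of a Lipschitz function under a product law *)

Section tensorization.
Context {R : realType} {n : nat}.
Variables (nu : probability (n.-tuple R) R) (mu : 'I_n -> probability R R).
Hypothesis nuE : forall A, (forall i, measurable (A i)) ->
  nu (box A) = (\prod_(i < n) mu i (A i))%E.
Variables (lambda K C : R).
Hypotheses (lambda_gt0 : 0 < lambda) (K_ge0 : 0 <= K) (C_ge0 : 0 <= C).
Hypothesis muC : forall i,
  (\int[mu i]_x (cosh (2 * (lambda * K) * x))%:E <= C%:E)%E.

(** Encodes two properties at once: the Lipschitz bound, and independence of [g t] from the
    coordinates below [k]. *)
Let lip (k : nat) (g : n.-tuple R -> R) := forall t t',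
  `|g t - g t'| <= K * \sum_(i < n | (k <= i)%N) `|tnth t i - tnth t' i|.

Let lip_measurable k g : lip k g -> measurable_fun [set: n.-tuple R] g.
Proof. exact: lipschitz_measurable. Qed.

Let section_laplace (g : n.-tuple R -> R) t (i : 'I_n) : measurable_fun [set: n.-tuple R] g ->
  (forall t, 0 <= g t) -> lip i g ->
  exists m, (\int[mu i]_x (g (update t i x))%:E = m%:E)%E /\
   (\int[mu i]_x (expR (lambda * g (update t i x)))%:E <=
    (expR (lambda * m) * C)%:E)%E.
Proof.
move=> mg g0 lg; apply: (@lipschitz_laplace_le _ _ _ K) => //.
- exact: (measurableT_comp mg (measurable_update_section _ _ t i)).
- move=> x y; apply: le_trans (lg _ _) _; rewrite ler_wpM2l//.
  rewrite (bigD1 i)//= !tnth_update eqxx big1 ?addr0// => j /andP[_ /negbTE ji].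
  by rewrite !tnth_update ji subrr normr0.
Qed.

(* The coordinates are averaged out one at a time; after [k] steps the function
   only depends on the coordinates of index at least [k]. *)
Let laplace_rec j : forall k (g : n.-tuple R -> R), (n - k = j)%N -> (k <= n)%N ->
  (forall t, 0 <= g t) -> lip k g ->
  exists m, (\int[nu]_t (g t)%:E = m%:E)%E /\
    (\int[nu]_t (expR (lambda * g t))%:E <= (expR (lambda * m) * C ^+ j)%:E)%E.
Proof.
elim: j => [|j IH] k g nk kn g0 lg.
  have nk' : k = n by lia.
  have gc t : g t = g [tuple 0 | i < n].
    apply/eqP; rewrite -subr_eq0 -normr_le0; apply: le_trans (lg _ _) _.
    rewrite big_pred0 ?mulr0// => i; rewrite nk' leqNgt ltn_ord//.
  exists (g [tuple 0 | i < n]); split.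
    under eq_integral do rewrite gc.
    by rewrite integral_cst// [X in (_ * X)%E](probability_setT nu) mule1.
  under eq_integral do rewrite gc.
  by rewrite integral_cst// [X in (_ * X)%E](probability_setT nu) mule1 expr0 mulr1.
have kn' : (k < n)%N by lia.
pose i := Ordinal kn'.
have mg := lip_measurable _ _ lg.
(* [h t] is the mean of [g] over coordinate [i], chosen as a real number. *)
have /choice[h hE] : forall t, exists m,
    (\int[mu i]_x (g (update t i x))%:E = m%:E)%E /\
    (\int[mu i]_x (expR (lambda * g (update t i x)))%:E <=
     (expR (lambda * m) * C)%:E)%E.
  by move=> t; exact: section_laplace.
have msec t : measurable_fun [set: R] (fun x => (g (update t i x))%:E).
  apply/measurable_EFinP.
  exact: (measurableT_comp mg (measurable_update_section _ _ t i)).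
have h0 t : 0 <= h t.
  rewrite -lee_fin -(hE t).1.
  by apply: integral_ge0 => x _; rewrite lee_fin.
(* For equal [x] the two updated tuples agree at [i], so the term of index [i] disappears from the
   Lipschitz bound. *)
have h_le t t' : h t <= h t' +
    K * \sum_(i < n | (k.+1 <= i)%N) `|tnth t i - tnth t' i|.
  rewrite -lee_fin EFinD -(hE t).1 -(hE t').1.
  set s := K * _.
  have s0 : 0 <= s by rewrite mulr_ge0// sumr_ge0.
  have -> : (\int[mu i]_x (g (update t' i x))%:E + s%:E =
      \int[mu i]_x ((g (update t' i x))%:E + s%:E))%E.
    rewrite ge0_integralD//; last by move=> x _; rewrite lee_fin.
    by rewrite integral_cst// [X in (_ * X)%E](probability_setT (mu i)) mule1.
  apply: ge0_le_integral => //.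
  - by move=> x _; rewrite lee_fin.
  - exact: emeasurable_funD.
  - move=> x _; rewrite -EFinD lee_fin -lerBlDl.
    apply: le_trans (ler_norm _) _; apply: le_trans (lg _ _) _.
    rewrite ler_wpM2l// (bigD1 i)//= !tnth_update eqxx subrr normr0 add0r.
    rewrite le_eqVlt; apply/orP; left; apply/eqP; apply: eq_big => l.
      rewrite -(inj_eq val_inj)/=; lia.
    by move=> /andP[_ /negbTE li]; rewrite !tnth_update li.
have lh : lip k.+1 h.
  move=> t t'; rewrite ler_norml lerBlDl h_le andbT.
  rewrite lerNl opprB lerBlDl; apply: le_trans (h_le t' t) _.
  by rewrite lerD2l ler_wpM2l//; apply: ler_sum => l _; rewrite distrC.
have [m [hm IHm]] := IH k.+1 h ltac:(lia) kn' h0 lh.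
have mh := lip_measurable _ _ lh.
exists m; split.
  rewrite (resampling _ _ nuE i)//; last exact/measurable_EFinP.
  by rewrite -hm; apply: eq_integral => t _; rewrite (hE t).1.
have mexpg : measurable_fun [set: n.-tuple R] (fun t => (expR (lambda * g t))%:E).
  apply/measurable_EFinP; apply: measurableT_comp => //; exact: measurable_funM.
have mexph : measurable_fun [set: n.-tuple R] (fun t => (expR (lambda * h t))%:E).
  apply/measurable_EFinP; apply: measurableT_comp => //; exact: measurable_funM.
rewrite (resampling _ _ nuE i)//.
(* Given the other coordinates, the inner integral costs one factor [C] and replaces [g] by [h],
   which has the same mean under [nu]. *)
apply: (@le_trans _ _ (\int[nu]_t ((expR (lambda * h t))%:E * C%:E))%E).
  apply: ge0_le_integral => //.
  - by move=> t _; apply: integral_ge0 => x _; rewrite lee_fin.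
  - pose G := (fun z : n.-tuple R * R => (expR (lambda * g (update z.1 i z.2)))%:E).
    apply: (@measurable_fun_fubini_tonelli_F _ _ _ _ _ (mu i) G).
      apply: (measurableT_comp mexpg).
      exact: (measurableT_comp (measurable_update i) (@measurable_swap _ _ _ _)).
    by move=> z; rewrite lee_fin.
  - by apply: emeasurable_funM.
  - by move=> t _; rewrite -EFinM; exact: (hE t).2.
rewrite ge0_integralZr//.
apply: le_trans (lee_wpmul2r _ IHm) _; first by rewrite lee_fin.
by rewrite -EFinM -mulrA -exprSr.
Qed.

Lemma product_laplace_le (g : n.-tuple R -> R) :
  (forall t, 0 <= g t) ->
  (forall t t', `|g t - g t'| <= K * \sum_(i < n) `|tnth t i - tnth t' i|) ->
  exists m, (\int[nu]_t (g t)%:E = m%:E)%E /\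
    (\int[nu]_t (expR (lambda * g t))%:E <= (expR (lambda * m) * C ^+ n)%:E)%E.
Proof. by move=> g0 gK; apply: (@laplace_rec n 0%N); rewrite ?subn0. Qed.
End tensorization.

(** * Integrals of step functions and two-sided exponentials *)

Section step_functions.
Context {R : realType}.
Local Notation leb := (@lebesgue_measure R).

Lemma measurable_fun_bool_natr d (T : measurableType d) (b : T -> bool) :
  measurable_fun [set: T] b -> measurable_fun [set: T] (fun x => (b x)%:R : R).
Proof.
move=> mb; rewrite (_ : (fun x => _) = fun x => if b x then 1 else 0).
  exact: measurable_fun_ifT.
by apply/funext => x; case: (b x).
Qed.

(** The effect of moving one sample point from [a] to [b]; averaged over the sample, it yields the
    Lipschitz constant [1 / n]. *)
Lemma integral_step_diff (a b : R) :
  (\int[leb]_s `|(a <= s)%R%:R - (b <= s)%R%:R|%:E = `|a - b|%:E)%E.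
Proof.
wlog ab : a b / a <= b.
  move=> H; case: (leP a b) => [|/ltW] ab; first exact: H.
  by rewrite distrC -H//; apply: eq_integral => s _; rewrite distrC.
transitivity (\int[leb]_s (\1_(`[a, b[%classic : set R) s)%:E)%E.
  apply: eq_integral => s _; rewrite indicE mem_setE in_itv/= ltNge.
  case: (leP b s) => bs; first by rewrite (le_trans ab bs) subrr normr0.
  by rewrite andbT subr0 ger0_norm.
rewrite integral_indic//= setIT lebesgue_measure_itv/= lte_fin.
move: ab; rewrite le_eqVlt => /predU1P[->|ab]; first by rewrite ltxx subrr normr0.
by rewrite ab distrC gtr0_norm ?subr_gt0.
Qed.

Lemma integral_exp_norm (a : R) : 0 < a ->
  (\int[leb]_s (expR (- (a * `|s|)))%:E = (2 / a)%:E)%E.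
Proof.
move=> a0.
have me D : measurable_fun D (fun s : R => (expR (- (a * `|s|)))%:E).
  apply/measurable_funTS/measurable_EFinP.
  apply: (measurableT_comp (@measurable_expR R)); apply: measurable_funN.
  by apply: measurable_funM => //; exact: normr_measurable.
have m1 : measurable (`]-oo, 0%R]%classic : set (measurableTypeR R)).
  exact: measurable_itv.
have m2 : measurable (`]0%R, +oo[%classic : set (measurableTypeR R)).
  exact: measurable_itv.
rewrite -[X in integral leb X](_ : `]-oo, 0%R] `|` `]0%R, +oo[ = setT); last first.
  by rewrite -set_itv_infty_infty -itv_bndbnd_setU.
rewrite (ge0_integral_setU leb m1 m2 (me _))//; last first.
  apply/disj_setPRL => s /=; rewrite !in_itv/= andbT => s0.
  by apply/negP; rewrite -ltNge.
rewrite integral_itv_obnd_cbnd; last exact: me.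
have -> : (\int[leb]_(s in `]-oo, 0%R]) (expR (- (a * `|s|)))%:E =
    \int[leb]_(s in `]-oo, 0%R]) (expR (a * s))%:E)%E.
  apply: eq_integral => s; rewrite inE/= in_itv/= => s0.
  by rewrite ler0_norm// mulrN opprK.
have -> : (\int[leb]_(s in `[0%R, +oo[) (expR (- (a * `|s|)))%:E =
    \int[leb]_(s in `[0%R, +oo[) (expR (- (a * s)))%:E)%E.
  by apply: eq_integral => s; rewrite inE/= in_itv/= andbT => s0; rewrite ger0_norm.
rewrite integral_expR_itvNyc// integral_expR_itvcy// mulr0 oppr0 expR0 -EFinD.
congr EFin; lra.
Qed.

End step_functions.

(** * Mean deviation of the empirical distribution function *)

Section empirical_deviation.
Context {R : realType} {n : nat}.
Hypothesis n_gt0 : (0 < n)%N.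
Variable F : CDF R.
Local Notation leb := (@lebesgue_measure R).

(** Extended-real valued because finiteness is only established later, in [deviation_fin_num]. *)
Definition deviation (t : n.-tuple R) : \bar R :=
  (\int[leb]_s `|F s - ecdf_fun n_gt0 (tnth t) s|%:E)%E.

Lemma deviation_ge0 t : (0 <= deviation t)%E.
Proof. by apply: integral_ge0 => s _; rewrite lee_fin. Qed.

Lemma measurable_ecdf_fun :
  measurable_fun setT (fun z : n.-tuple R * R => ecdf_fun n_gt0 (tnth z.1) z.2).
Proof.
apply: measurable_funM => //.
apply: measurable_sum => i; apply: measurable_fun_bool_natr.
apply: measurable_fun_ler; last exact: measurable_snd.
exact: (measurableT_comp (measurable_tnth i) measurable_fst).
Qed.

Let k (z : n.-tuple R * R) : \bar R := `|F z.2 - ecdf_fun n_gt0 (tnth z.1) z.2|%:E.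

Let k_ge0 z : (0 <= k z)%E. Proof. by rewrite lee_fin. Qed.

Let mk : measurable_fun setT k.
Proof.
apply/measurable_EFinP; apply: measurableT_comp => //.
apply: measurable_funB; last exact: measurable_ecdf_fun.
exact: (measurableT_comp (measurable_CDF F) measurable_snd).
Qed.

Lemma measurable_deviation : measurable_fun [set: n.-tuple R] deviation.
Proof. exact: (measurable_fun_fubini_tonelli_F (m2 := leb) k). Qed.

Lemma ecdf_dist_le (t t' : n.-tuple R) s :
  `|ecdf_fun n_gt0 (tnth t) s - ecdf_fun n_gt0 (tnth t') s| <=
  n%:R^-1 * \sum_(i < n) `|(tnth t i <= s)%R%:R - (tnth t' i <= s)%R%:R|.
Proof.
rewrite /ecdf_fun -mulrBr normrM ger0_norm ?invr_ge0// ler_wpM2l ?invr_ge0//.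
by rewrite -sumrB; exact: ler_norm_sum.
Qed.

Lemma integral_ecdf_dist_le (t t' : n.-tuple R) :
  (\int[leb]_s `|ecdf_fun n_gt0 (tnth t) s - ecdf_fun n_gt0 (tnth t') s|%:E <=
   (n%:R^-1 * \sum_(i < n) `|tnth t i - tnth t' i|)%:E)%E.
Proof.
have mi i : measurable_fun [set: R]
    (fun s => `|(tnth t i <= s)%R%:R - (tnth t' i <= s)%R%:R|%:E : \bar R).
  apply/measurable_EFinP/measurableT_comp => //.
  by apply: measurable_funB; apply: measurable_fun_bool_natr; exact: measurable_fun_ler.
have mt (u : n.-tuple R) : measurable_fun [set: R] (ecdf_fun n_gt0 (tnth u)).
  exact: (measurableT_comp measurable_ecdf_fun (pair1_measurable u)).
have sumE : (\int[leb]_s (\sum_(i < n) `|(tnth t i <= s)%R%:R - (tnth t' i <= s)%R%:R|%:E)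
    = \sum_(i < n) `|tnth t i - tnth t' i|%:E)%E.
  rewrite ge0_integral_sum//.
  by apply: eq_bigr => i _; exact: integral_step_diff.
rewrite EFinM -sumEFin -sumE -ge0_integralZl//; try solve [exact: emeasurable_sum
  | by move=> s _; apply: sume_ge0 => i _; rewrite lee_fin | by rewrite lee_fin invr_ge0].
apply: ge0_le_integral => //.
- apply/measurable_EFinP/measurableT_comp => //.
  by apply: measurable_funB; exact: mt.
- by apply: emeasurable_funM => //; exact: emeasurable_sum.
- by move=> s _; rewrite sumEFin -EFinM lee_fin ecdf_dist_le.
Qed.

(** Stated additively since both deviations could still be infinite. *)
Lemma deviation_lipschitz t t' : (deviation t <=
  deviation t' + (n%:R^-1 * \sum_(i < n) `|tnth t i - tnth t' i|)%:E)%E.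
Proof.
apply: (@le_trans _ _ (deviation t' + \int[leb]_s
    `|ecdf_fun n_gt0 (tnth t) s - ecdf_fun n_gt0 (tnth t') s|%:E)%E); last first.
  by rewrite leeD2l// integral_ecdf_dist_le.
have mt (u : n.-tuple R) : measurable_fun [set: R] (ecdf_fun n_gt0 (tnth u)).
  exact: (measurableT_comp measurable_ecdf_fun (pair1_measurable u)).
have md (f g : R -> R) : measurable_fun [set: R] f -> measurable_fun [set: R] g ->
    measurable_fun [set: R] (fun s => `|f s - g s|%:E).
  move=> mf mg; apply/measurable_EFinP/measurableT_comp => //.
  exact: measurable_funB.
rewrite /deviation -ge0_integralD//; last 2 first.
- by apply: md => //; exact: measurable_CDF.
- exact: md.
apply: ge0_le_integral => //.
- by apply: md => //; exact: measurable_CDF.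
- by apply: emeasurable_funD; [apply: md => //; exact: measurable_CDF|exact: md].
- move=> s _; rewrite -EFinD lee_fin.
  rewrite (_ : F s - ecdf_fun n_gt0 (tnth t) s = (F s - ecdf_fun n_gt0 (tnth t') s) -
    (ecdf_fun n_gt0 (tnth t) s - ecdf_fun n_gt0 (tnth t') s)); last by ring.
  exact: ler_normB.
Qed.

Variables (nu : probability (n.-tuple R) R) (mu : 'I_n -> probability R R).
Hypothesis nuE : forall A, (forall i, measurable (A i)) ->
  nu (box A) = (\prod_(i < n) mu i (A i))%E.
Hypothesis muF : forall i r, mu i [set x | (x <= r)%R] = (F r)%:E.

Let y s (t : n.-tuple R) i : R := (tnth t i <= s)%R%:R - F s.

Let my s i : measurable_fun [set: n.-tuple R] (fun t => y s t i).
Proof.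
apply: measurable_funB => //; apply: measurable_fun_bool_natr.
by apply: measurable_fun_ler => //; exact: measurable_tnth.
Qed.

Let integral_two_valued i s (a b : R) : 0 <= a -> 0 <= b ->
  (\int[mu i]_x (if (x <= s)%R then a else b)%:E = (F s * a + (1 - F s) * b)%:E)%E.
Proof.
move=> a0 b0.
have mA : measurable [set x : R | x <= s] by rewrite -set_itvNyc.
have mi (A : set R) : measurable A ->
    measurable_fun [set: R] (fun x => (\1_A x)%:E : \bar R).
  by move=> ?; apply/measurable_EFinP; exact: measurable_indic.
transitivity (\int[mu i]_x (a%:E * (\1_[set x : R | x <= s] x)%:E +
    b%:E * (\1_(~` [set x : R | x <= s]) x)%:E))%E.
  apply: eq_integral => x _; rewrite -!EFinM -EFinD !indicE in_setC.
  have -> : (x \in [set x : R | x <= s]) = (x <= s) by apply/idP/idP; rewrite inE.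
  by case: ifP => _; congr EFin => /=; ring.
rewrite ge0_integralD//; last 4 first.
- by move=> x _; rewrite -EFinM lee_fin mulr_ge0.
- by apply: emeasurable_funM => //; exact: mi.
- by move=> x _; rewrite -EFinM lee_fin mulr_ge0.
- by apply: emeasurable_funM => //; apply: mi; exact: measurableC.
rewrite !ge0_integralZl//; try solve [exact: mi | by move=> x _; rewrite lee_fin
  | by apply: mi; exact: measurableC].
rewrite !integral_indic//; last exact: measurableC.
have muC : mu i (~` [set x : R | x <= s]) = (1 - (F s)%:E)%E.
  by rewrite -(muF i); exact: probability_setC.
transitivity (a%:E * mu i [set x : R | (x <= s)%R] +
    b%:E * mu i (~` [set x : R | (x <= s)%R]))%E; first by rewrite !setIT.
rewrite muC muF -EFinB -!EFinM -EFinD.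
by congr EFin; ring.
Qed.

Let msum s m : measurable_fun [set: n.-tuple R]
  (fun t => ((\sum_(i < n | (m <= i)%N) y s t i) ^+ 2)%:E).
Proof.
apply/measurable_EFinP/measurable_funX.
under eq_fun do rewrite big_mkcond.
by apply: measurable_sum => i; case: (m <= i)%N.
Qed.

(** The summands are independent and centred: integrating out coordinate [m] kills the cross term
    and adds [F s (1 - F s)] to the square of the remaining sum. *)
Lemma variance_rec s j : forall m, (n - m = j)%N -> (m <= n)%N ->
  (\int[nu]_t ((\sum_(i < n | (m <= i)%N) y s t i) ^+ 2)%:E =
   (j%:R * (F s * (1 - F s)))%:E)%E.
Proof.
elim: j => [|j IH] m nm mn.
  rewrite mul0r integral0_eq// => t _.
  rewrite big_pred0 ?expr0n// => i; have := ltn_ord i; lia.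
have mn1 : (m < n)%N by lia.
pose i := Ordinal mn1.
rewrite (resampling _ _ nuE i)//; last by move=> t; rewrite lee_fin sqr_ge0.
have F0 := CDF_ge0 F s; have F1 := CDF_le1 F s.
transitivity (\int[nu]_t (((\sum_(l < n | (m.+1 <= l)%N) y s t l) ^+ 2)%:E +
    (F s * (1 - F s))%:E))%E.
  apply: eq_integral => t _.
  set S := \sum_(l < n | (m.+1 <= l)%N) y s t l.
  transitivity (\int[mu i]_x (if (x <= s)%R then (1 - F s + S) ^+ 2 else
      (S - F s) ^+ 2)%:E)%E.
    apply: eq_integral => x _; congr EFin.
    rewrite (bigD1 i)//= {1}/y tnth_update eqxx.
    have -> : \sum_(l < n | (m <= l)%N && (l != i)) y s (update t i x) l = S.
      apply: eq_big => l; first by rewrite -(inj_eq val_inj)/=; lia.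
      by move=> /andP[_ /negbTE li]; rewrite /y tnth_update li.
    by case: ifP => _ /=; ring.
  rewrite integral_two_valued ?sqr_ge0// -EFinD; congr EFin; ring.
rewrite ge0_integralD//; last 2 first.
- by move=> t _; rewrite lee_fin sqr_ge0.
- by move=> t _; rewrite lee_fin mulr_ge0// subr_ge0.
rewrite IH; [|lia|lia].
rewrite integral_cst// [X in (_ * X)%E](probability_setT nu) mule1 -EFinD.
by congr EFin; rewrite -natr1; ring.
Qed.

Variable c : R.
Hypothesis c_gt0 : 0 < c.
Hypothesis F_right : forall s, 0 <= s -> 1 - F s <= expR (- (c * s)).
Hypothesis F_left : forall s, 0 <= s -> F (- s) <= expR (- (c * s)).

Let F_variance_le s : F s * (1 - F s) <= expR (- (c * `|s|)).
Proof.
have F0 := CDF_ge0 F s; have F1 := CDF_le1 F s.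
case: (leP 0 s) => s0.
  rewrite ger0_norm//; apply: le_trans (F_right _ s0).
  by rewrite ler_piMl// subr_ge0.
rewrite ltr0_norm//; have := F_left (- s); rewrite opprK oppr_ge0 => /(_ (ltW s0)).
by move=> h; apply: le_trans h; rewrite ler_piMr// lerBlDr lerDl.
Qed.

(** The variance at [s] decays at rate [c], so the standard deviation decays at rate [c / 2], whose
    two-sided integral is [2 / (c / 2) = 4 / c]. *)
Lemma mean_deviation_le :
  (\int[nu]_t deviation t <= (4 / (c * Num.sqrt n%:R))%:E)%E.
Proof.
have n0 : 0 < n%:R :> R by rewrite ltr0n.
pose rn := Num.sqrt (n%:R : R).
have rn0 : 0 < rn by rewrite sqrtr_gt0.
have rn2 : rn ^+ 2 = n%:R by rewrite sqr_sqrtr ?ler0n.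
have -> : (\int[nu]_t deviation t = \int[leb]_s \int[nu]_t k (t, s))%E.
  exact: (fubini_tonelli (m1 := nu) (m2 := leb) k).
apply: (@le_trans _ _ (\int[leb]_s ((rn^-1)%:E * (expR (- (c / 2 * `|s|)))%:E))%E); last first.
  rewrite ge0_integralZl//; last 2 first.
  - apply/measurable_EFinP.
    apply: (measurableT_comp (@measurable_expR R)); apply: measurable_funN.
    by apply: measurable_funM => //; exact: normr_measurable.
  - by rewrite lee_fin invr_ge0 ltW.
  rewrite integral_exp_norm ?divr_gt0// -EFinM lee_fin le_eqVlt; apply/orP; left.
  apply/eqP; rewrite -/rn; field.
  by rewrite !gt_eqF.
apply: ge0_le_integral => //.
- by move=> s _; apply: integral_ge0.
- exact: (measurable_fun_fubini_tonelli_G (m1 := nu) k).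
- apply: emeasurable_funM => //; apply/measurable_EFinP.
  apply: (measurableT_comp (@measurable_expR R)); apply: measurable_funN.
  by apply: measurable_funM => //; exact: normr_measurable.
move=> s _.
set e := expR (- (c / 2 * `|s|)).
have e0 : 0 < e by exact: expR_gt0.
have e2 : e ^+ 2 = expR (- (c * `|s|)).
  rewrite /e -expRM_natr; congr (expR _); lra.
pose dl := rn^-1 * e.
have dl0 : 0 < dl by rewrite mulr_gt0// invr_gt0.
(* AM-GM: [2 |z| <= z^2 / dl + dl], with [dl^2] bounding the variance of [z] *)
apply: (@le_trans _ _ (\int[nu]_t (((2 * dl * n%:R ^+ 2)^-1)%:E *
   ((\sum_(i < n | (0 <= i)%N) y s t i) ^+ 2)%:E + (dl / 2)%:E))%E).
  apply: ge0_le_integral => //.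
  - exact: (measurableT_comp mk (pair2_measurable s)).
  - by apply: emeasurable_funD => //; apply: emeasurable_funM => //; exact: msum.
  - move=> t _; rewrite /k/= -EFinM -EFinD lee_fin.
    have -> : F s - ecdf_fun n_gt0 (tnth t) s =
        - (n%:R^-1 * (\sum_(i < n | (0 <= i)%N) y s t i)).
      rewrite /y sumrB sumr_const /ecdf_fun card_ord mulrBr opprB; congr (_ - _).
      by rewrite -[F s *+ n]mulr_natr mulrCA mulVf ?mulr1// gt_eqF.
    rewrite normrN; set S := \sum_(i < n | _) _.
    rewrite normrM ger0_norm; last by rewrite invr_ge0 ltW.
    rewrite -(real_normK (num_real S)); move: (normr_ge0 S); move: `|S| => z z0.
    have := sqr_ge0 (z / n%:R - dl).
    rewrite sqrrB => H.
    rewrite -subr_ge0.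
    rewrite (_ : _ - _ = ((z / n%:R) ^+ 2 - z / n%:R * dl *+ 2 + dl ^+ 2) / (2 * dl)).
      by rewrite divr_ge0// mulr_ge0// ltW.
    field; rewrite !gt_eqF//.
have kp0 : 0 <= (2 * dl * n%:R ^+ 2)^-1 by rewrite invr_ge0 mulr_ge0 ?sqr_ge0// mulr_ge0// ltW.
rewrite ge0_integralD//; try solve [by move=> t _; rewrite -?EFinM lee_fin ?mulr_ge0// ?sqr_ge0
  | by apply: emeasurable_funM => //; exact: msum
  | by move=> t _; rewrite lee_fin divr_ge0// ltW].
rewrite integral_cst// [X in (_ + _ * X)%E](probability_setT nu) mule1.
rewrite ge0_integralZl//; try solve [exact: msum | by move=> t _; rewrite lee_fin sqr_ge0].
rewrite (@variance_rec s n 0%N) ?subn0// -!EFinM -EFinD lee_fin -/dl.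
have q_le : F s * (1 - F s) <= n%:R * dl ^+ 2.
  apply: le_trans (F_variance_le s) _.
  rewrite -e2 /dl exprMn exprVn rn2 mulrA mulfV ?mul1r// gt_eqF//.
apply: (@le_trans _ _ ((2 * dl * n%:R ^+ 2)^-1 * (n%:R * (n%:R * dl ^+ 2)) + dl / 2)).
  by rewrite lerD2r ler_wpM2l// ler_wpM2l.
rewrite le_eqVlt; apply/orP; left; apply/eqP; field.
by rewrite !gt_eqF.
by move=> t _; rewrite -EFinM lee_fin mulr_ge0// sqr_ge0.
Qed.
End empirical_deviation.

(** * Concentration *)

Section deviation_inequality.
Context {R : realType} {n : nat}.
Hypothesis n_gt0 : (0 < n)%N.
Variables (F : CDF R) (nu : probability (n.-tuple R) R) (mu : 'I_n -> probability R R).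
Hypothesis nuE : forall A, (forall i, measurable (A i)) ->
  nu (box A) = (\prod_(i < n) mu i (A i))%E.
Hypothesis muF : forall i r, mu i [set x | (x <= r)%R] = (F r)%:E.
Variable c : R.
Hypothesis c_gt0 : 0 < c.
Hypothesis F_right : forall s, 0 <= s -> 1 - F s <= expR (- (c * s)).
Hypothesis F_left : forall s, 0 <= s -> F (- s) <= expR (- (c * s)).

Local Notation dev := (deviation n_gt0 F).

Let rn := Num.sqrt (n%:R : R).
Let n0 : 0 < n%:R :> R. Proof. by rewrite ltr0n. Qed.
Let rn0 : 0 < rn. Proof. by rewrite sqrtr_gt0. Qed.

(** A finite mean forces one finite value, and the Lipschitz bound carries finiteness from there to
    every sample. *)
Lemma deviation_fin_num t : dev t \is a fin_num.
Proof.
have [t0 ht0] : exists t0, (dev t0 < +oo)%E.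
  apply: contrapT => H.
  have : (\int[nu]_t dev t = +oo)%E.
    transitivity (\int[nu]_(t in setT) (cst +oo t))%E.
      apply: eq_integral => t1 _ /=; apply/eqP; rewrite -leye_eq leNgt.
      by apply/negP => h; apply: H; exists t1.
    by rewrite integral_cst// [X in (_ * X)%E](probability_setT nu) mule1.
  have := mean_deviation_le n_gt0 _ _ _ nuE muF _ c_gt0 F_right F_left.
  by move=> + E; rewrite E leye_eq.
rewrite ge0_fin_numE ?deviation_ge0//.
apply: le_lt_trans (deviation_lipschitz n_gt0 F t t0) _.
by rewrite lte_add_pinfty// ltry.
Qed.

Let fdev t := fine (dev t).

Let fdevE t : (fdev t)%:E = dev t. Proof. by rewrite fineK ?deviation_fin_num. Qed.

Lemma deviation_tail_le (w : R) : 0 < w ->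
  (nu [set t | ((4 / (c * rn) + w)%:E < dev t)%E] <=
   (expR (- (n%:R * (c * w) ^+ 2 / (32 + 4 * (c * w)))))%:E)%E.
Proof.
move=> w0.
pose u := c * w; have u0 : 0 < u by rewrite mulr_gt0.
(* Bernstein's choice: it turns the Chernoff exponent per observation, [- s u + 8 s^2 / (1 - 2 s)],
   into [- u^2 / (32 + 4 u)]. *)
pose s := u / (16 + 2 * u).
have D0 : 0 < 16 + 2 * u by rewrite addr_gt0// mulr_gt0.
have s0 : 0 < s by rewrite divr_gt0.
have s1 : 2 * s < 1.
  by rewrite /s mulrA ltr_pdivrMr// mul1r ltrDr.
(* Scaled by [n] to offset the Lipschitz constant [1 / n]: the [cosh] parameter becomes [2 c s],
   below [c] because [2 s < 1]. *)
pose la := n%:R * c * s; have la0 : 0 < la by rewrite mulr_gt0// mulr_gt0.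
have laK : 2 * (la * n%:R^-1) = 2 * c * s.
  by rewrite /la; field; rewrite gt_eqF.
pose C := 1 + 8 * s ^+ 2 / (1 - 4 * s ^+ 2).
have s4 : 0 < 1 - 4 * s ^+ 2.
  rewrite (_ : 1 - _ = (1 - 2 * s) * (1 + 2 * s)); last by ring.
  by rewrite mulr_gt0// ?subr_gt0// addr_gt0// mulr_gt0.
have C0 : 0 <= C.
  by rewrite addr_ge0// divr_ge0 ?(ltW s4)// mulr_ge0// sqr_ge0.
have muC i : (\int[mu i]_x (cosh (2 * (la * n%:R^-1) * x))%:E <= C%:E)%E.
  rewrite laK.
  have -> : C = 1 + 2 * (2 * c * s) ^+ 2 / (c ^+ 2 - (2 * c * s) ^+ 2).
    rewrite /C; congr (1 + _).
    rewrite (_ : c ^+ 2 - _ = c ^+ 2 * (1 - 4 * s ^+ 2)); last by ring.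
    by field; rewrite !gt_eqF.
  apply: (@integral_cosh_le _ (mu i) c c_gt0).
  - move=> e e0.
    have -> : (mu i [set x : R | (e < x)%R] = (1 - F e)%:E)%E.
      have mA : measurable [set x : R | x <= e] by rewrite -set_itvNyc.
      rewrite EFinB -(muF i) -probability_setC//; congr (mu i _).
      by apply/seteqP; split => x /=; rewrite ltNge => /negP.
    by rewrite lee_fin F_right.
  - by move=> e e0; rewrite muF lee_fin F_left.
  - apply/andP; split; first by rewrite mulr_gt0// mulr_gt0.
    by rewrite mulrAC -[ltRHS]mul1r ltr_pM2r.
have fdev_lip t t' : `|fdev t - fdev t'| <= n%:R^-1 * \sum_(i < n) `|tnth t i - tnth t' i|.
  have H t1 t2 : fdev t1 - fdev t2 <= n%:R^-1 * \sum_(i < n) `|tnth t1 i - tnth t2 i|.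
    by rewrite lerBlDl -lee_fin EFinD !fdevE deviation_lipschitz.
  rewrite ler_norml H andbT lerNl opprB.
  apply: le_trans (H t' t) _; rewrite ler_wpM2l ?invr_ge0//.
  by apply: ler_sum => i _; rewrite distrC.
have fdev0 t : 0 <= fdev t by rewrite fine_ge0// deviation_ge0.
have [m [hm hexp]] := product_laplace_le nu mu nuE la n%:R^-1 C la0
  ltac:(by rewrite invr_ge0) C0 muC fdev fdev0 fdev_lip.
have m_le : m <= 4 / (c * rn).
  rewrite -lee_fin -hm; under eq_integral do rewrite fdevE.
  exact: (mean_deviation_le n_gt0 _ _ _ nuE muF _ c_gt0 F_right F_left).
set a := 4 / (c * rn) + w.
have mfdev : measurable_fun [set: n.-tuple R] fdev.
  by apply: (@lipschitz_measurable _ _ predT n%:R^-1); rewrite ?invr_ge0.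
set A := [set t | _].
have mA : measurable A.
  have := measurable_fun_ltr (measurable_cst a) mfdev.
  move=> /(_ measurableT [set true]); rewrite setTI => /(_ I).
  congr (measurable _); apply/seteqP; split => t /=; by rewrite /A/= -fdevE lte_fin.
have markov : ((expR (la * a))%:E * nu A <= (expR (la * m) * C ^+ n)%:E)%E.
  apply: le_trans hexp.
  rewrite -[X in (_ * nu X)%E]setIT -integral_indic// -ge0_integralZl//; last first.
    exact/measurable_EFinP/measurable_indic.
  have mexp : measurable_fun [set: n.-tuple R] (fun t => (expR (la * fdev t))%:E).
    apply/measurable_EFinP; apply: measurableT_comp => //; exact: measurable_funM.
  apply: ge0_le_integral => //.
  - by apply: emeasurable_funM => //; exact/measurable_EFinP/measurable_indic.
  - move=> t _; rewrite indicE -EFinM lee_fin; case: (boolP (t \in A)) => [|_].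
      rewrite inE /A/= -fdevE lte_fin => at_; rewrite mulr1 ler_expR ler_pM2l//.
      exact: ltW.
    by rewrite mulr0 expR_ge0.
have nuAfin : nu A \is a fin_num by rewrite fin_num_measure.
move: markov; rewrite -(fineK nuAfin) -EFinM !lee_fin; set p := fine _ => markov.
have Cn : C ^+ n <= expR (n%:R * (8 * s ^+ 2 / (1 - 4 * s ^+ 2))).
  by rewrite expRM_natl; apply: lerXn2r; rewrite ?nnegrE ?expR_ge0// expR_ge1Dx.
have : p <= expR (- (la * a)) * (expR (la * m) * C ^+ n).
  rewrite -[leLHS]mul1r -(expRxMexpNx_1 (la * a)) [expR (la * a) * _]mulrC -mulrA.
  by rewrite ler_pM2l ?expR_gt0.
move=> /le_trans; apply.
apply: (@le_trans _ _ (expR (- (la * a)) * (expR (la * m) *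
    expR (n%:R * (8 * s ^+ 2 / (1 - 4 * s ^+ 2)))))).
  by rewrite !ler_pM2l ?expR_gt0.
rewrite -!expRD ler_expR.
have h1 : la * m <= la * (a - w) by rewrite ler_pM2l// /a addrK.
(* As [2 s < 1], [4 s^2 <= 2 s]; this brings the exponent into the form that [s] was chosen for. *)
have h2 : 8 * s ^+ 2 / (1 - 4 * s ^+ 2) <= 8 * s ^+ 2 / (1 - 2 * s).
  rewrite ler_wpM2l//; first by rewrite mulr_ge0// sqr_ge0.
  rewrite lef_pV2 ?posrE//; last by rewrite subr_gt0.
  rewrite lerD2l lerN2 (_ : 4 * s ^+ 2 = 2 * s * (2 * s)); last by ring.
  by rewrite ler_piMr ?(ltW s1)// mulr_ge0// ltW.
have h3 : n%:R * (8 * s ^+ 2 / (1 - 4 * s ^+ 2)) <= n%:R * (8 * s ^+ 2 / (1 - 2 * s)).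
  by apply: ler_wpM2l => //; exact: ltW.
apply: (@le_trans _ _ (- (la * w) + n%:R * (8 * s ^+ 2 / (1 - 2 * s)))); first by lra.
rewrite le_eqVlt; apply/orP; left; apply/eqP.
rewrite /la (_ : n%:R * c * s * w = n%:R * s * u); last by rewrite /u; ring.
rewrite -/u /s.
have D2 : 32 + 4 * u = 2 * (16 + 2 * u) by ring.
have -> : 1 - 2 * (u / (16 + 2 * u)) = 16 / (16 + 2 * u).
  by field; rewrite gt_eqF.
rewrite D2; field; rewrite gt_eqF//.
Qed.
End deviation_inequality.

(** * Risk measures of type (T2) *)

Section type_T2_consequences.
Context {R : realType}.
Variables (rho : CDF R -> R) (alpha1 alpha2 alpha3 L1 L2 L3 K1 K2 gamma : R).
Hypothesis rhoT2 : type_T2 rho alpha1 alpha2 alpha3 L1 L2 L3 K1 K2 gamma.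
Local Notation leb := (@lebesgue_measure R).

Let alpha1_gt0 : 0 < alpha1. Proof. by case: rhoT2 => [[/andP[]]]. Qed.
Let alpha2_gt0 : 0 < alpha2. Proof. by case: rhoT2 => [[]]. Qed.
Let alpha3_gt0 : 0 < alpha3. Proof. by case: rhoT2 => [[]]. Qed.
Let L1_gt0 : 0 < L1. Proof. by case: rhoT2 => [_ []]. Qed.
Let L2_gt0 : 0 < L2. Proof. by case: rhoT2 => [_ []]. Qed.
Let L3_gt0 : 0 < L3. Proof. by case: rhoT2 => [_ []]. Qed.
Let K1_gt0 : 0 < K1. Proof. by case: rhoT2 => [_ _ [/andP[]]]. Qed.
Let K2_gt0 : 0 < K2. Proof. by case: rhoT2 => [_ _ [_ /andP[]]]. Qed.
Let T2 (F G : CDF R) (tau : R) : 0 < tau ->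
  (`|rho F - rho (trunc_cdf tau G)|%:E <=
    L1%:E * wasserstein1 F G `^ alpha1 * (tau `^ gamma)%:E
    + L2%:E * \int[leb]_(z in `[(K1 * tau)%R, +oo[) ((1 - F z) `^ alpha2)%:E
    + L3%:E * \int[leb]_(z in `]-oo, (- (K2 * tau))%R]) (F z `^ alpha3)%:E)%E.
Proof. by case: rhoT2 => _ _ _; exact. Qed.

Lemma wasserstein1_ge0 (F G : CDF R) : (0 <= wasserstein1 F G)%E.
Proof.
by apply: le_ereal_inf_tmp => _ [pi _ <-]; apply: integral_ge0 => z _; rewrite lee_fin.
Qed.

Lemma wasserstein1_poweR_le (F G : CDF R) (q : R) : (wasserstein1 F G <= q%:E)%E ->
  (wasserstein1 F G `^ alpha1 <= (q `^ alpha1)%:E)%E.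
Proof.
move=> Wq; rewrite -poweR_EFin; have W0 := wasserstein1_ge0 F G.
apply: gt0_ler_poweR => //; first exact: ltW.
- by rewrite in_itv/= W0 leey.
- by rewrite in_itv/= (le_trans W0 Wq) leey.
Qed.

(** The powers [alpha2] and [alpha3] only rescale the decay rate [c] of the tails, and the resulting
    exponentials integrate to exactly the terms subtracted from [eps]. The real [q] stands in for
    the extended-real distance. *)
Lemma rho_truncation_le (F G : CDF R) (tau c q : R) : 0 < tau -> 0 < c ->
  (forall s, 0 <= s -> 1 - F s <= expR (- (c * s))) ->
  (forall s, 0 <= s -> F (- s) <= expR (- (c * s))) ->
  (wasserstein1 F G <= q%:E)%E ->
  `|rho F - rho (trunc_cdf tau G)| <= L1 * q `^ alpha1 * tau `^ gamma
    + L2 / (c * alpha2) * expR (- (alpha2 * c * K1 * tau))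
    + L3 / (c * alpha3) * expR (- (alpha3 * c * K2 * tau)).
Proof.
move=> tau0 c0 Fr Fl Wq; rewrite -lee_fin; apply: le_trans (T2 F G tau tau0) _.
have F0 z := CDF_ge0 F z; have F1 z := CDF_le1 F z.
rewrite !EFinD; apply: leeD; first apply: leeD.
- rewrite !EFinM lee_wpmul2r ?lee_fin ?powR_ge0//.
  by rewrite lee_wpmul2l ?lee_fin ?(ltW L1_gt0)// wasserstein1_poweR_le.
- rewrite -[L2 / _ * _]mulrA EFinM lee_wpmul2l ?lee_fin ?(ltW L2_gt0)//.
  apply: (@le_trans _ _ (\int[leb]_(z in `[(K1 * tau)%R, +oo[)
      (expR (- (alpha2 * c * z)))%:E)%E).
    apply: ge0_le_integral => //.
    + by move=> z _; rewrite lee_fin powR_ge0.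
    + apply/measurable_funTS/measurable_EFinP.
      apply: (measurableT_comp (measurable_powR _)).
      by apply: measurable_funB => //; exact: measurable_CDF.
    + apply/measurable_funTS/measurable_EFinP.
      apply: (measurableT_comp (@measurable_expR R)); apply: measurable_funN.
      exact: measurable_funM.
    + move=> z; rewrite /= in_itv/= andbT => Kz; rewrite lee_fin.
      have z0 : 0 <= z by apply: le_trans Kz; rewrite mulr_ge0 ?ltW.
      rewrite (_ : - (alpha2 * c * z) = - (c * z) * alpha2); last by ring.
      rewrite expRM ge0_ler_powR ?nnegrE ?expR_ge0 ?subr_ge0 ?(ltW alpha2_gt0)//.
      exact: Fr.
  rewrite integral_expR_itvcy ?mulr_gt0// lee_fin mulrC.
  by rewrite [c * _]mulrC !mulrA.
- rewrite -[L3 / _ * _]mulrA EFinM lee_wpmul2l ?lee_fin ?(ltW L3_gt0)//.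
  apply: (@le_trans _ _ (\int[leb]_(z in `]-oo, (- (K2 * tau))%R])
      (expR (alpha3 * c * z))%:E)%E).
    apply: ge0_le_integral => //.
    + by move=> z _; rewrite lee_fin powR_ge0.
    + apply/measurable_funTS/measurable_EFinP.
      by apply: (measurableT_comp (measurable_powR _)); exact: measurable_CDF.
    + apply/measurable_funTS/measurable_EFinP.
      apply: (measurableT_comp (@measurable_expR R)).
      exact: measurable_funM.
    + move=> z; rewrite /= in_itv/= => Kz; rewrite lee_fin.
      have z0 : 0 <= - z by rewrite oppr_ge0 (le_trans Kz)// oppr_le0 mulr_ge0 ?ltW.
      rewrite (_ : alpha3 * c * z = - (c * - z) * alpha3); last by ring.
      rewrite expRM ge0_ler_powR ?nnegrE ?expR_ge0 ?(ltW alpha3_gt0)//.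
      by rewrite -{1}(opprK z) Fl.
  rewrite integral_expR_itvNyc ?mulr_gt0// lee_fin mulrC.
  by rewrite [c * alpha3]mulrC mulrN !mulrA.
Qed.

Definition cdf_supported (tau : R) (F : CDF R) :=
  (forall z, z < - tau -> F z = 0) /\ (forall z, tau <= z -> F z = 1).

Lemma trunc_cdf_supported tau (F : CDF R) : 0 < tau -> cdf_supported tau (trunc_cdf tau F).
Proof.
move=> tau0; split => z zt; rewrite /trunc_cdf/= /trunc_fun.
  rewrite [- tau <= z]leNgt zt /= mulr0 add0r leNgt.
  by rewrite (lt_trans zt) ?gtrN.
by rewrite [z < tau]ltNge zt andbF mulr0 add0r.
Qed.

(* For CDFs supported in [- tau, tau] the tail terms of (T2) vanish as soon as
   the truncation level is large compared to tau. *)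
Lemma rho_holder (tau : R) : 0 < tau -> exists2 M, 0 < M &
  forall (F G : CDF R) (q : R), cdf_supported tau F -> cdf_supported tau G ->
    (wasserstein1 F G <= q%:E)%E -> `|rho F - rho G| <= M * q `^ alpha1.
Proof.
(* Both [K1 * tau'] and [K2 * tau'] then exceed [2 * tau]. Strictness matters on the left, where [F]
   may jump at [- tau]. *)
move=> tau0; pose tau' := 2 * tau / K1 + 2 * tau / K2.
have k1 : 0 < 2 * tau / K1 by rewrite divr_gt0// mulr_gt0.
have k2 : 0 < 2 * tau / K2 by rewrite divr_gt0// mulr_gt0.
have tau'0 : 0 < tau' by rewrite addr_gt0.
have K1t : tau <= K1 * tau'.
  rewrite /tau' mulrDr mulrC divfK ?gt_eqF//.
  by have := mulr_gt0 K1_gt0 k2; lra.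
have K2t : tau < K2 * tau'.
  rewrite /tau' mulrDr [X in _ + X]mulrC divfK ?gt_eqF//.
  by have := mulr_gt0 K2_gt0 k1; lra.
exists (L1 * tau' `^ gamma); first by rewrite mulr_gt0// powR_gt0.
have H (F G : CDF R) q : cdf_supported tau F -> (wasserstein1 F G <= q%:E)%E ->
    `|rho F - rho (trunc_cdf tau' G)| <= L1 * tau' `^ gamma * q `^ alpha1.
  move=> [F0 F1] Wq; rewrite -lee_fin; apply: le_trans (T2 F G tau' tau'0) _.
  rewrite [X in (_ + L2%:E * X + _)%E]integral0_eq; last first.
    move=> z; rewrite /= in_itv/= andbT => Kz.
    by rewrite F1 ?(le_trans K1t)// subrr powR0// gt_eqF.
  rewrite [X in (_ + L3%:E * X)%E]integral0_eq; last first.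
    move=> z; rewrite /= in_itv/= => Kz.
    by rewrite F0 ?powR0 ?gt_eqF// (le_lt_trans Kz)// ltrN2.
  rewrite !mule0 !adde0 mulrAC !EFinM lee_wpmul2r ?lee_fin ?powR_ge0//.
  by rewrite lee_wpmul2l ?lee_fin ?(ltW L1_gt0)// wasserstein1_poweR_le.
move=> F G q sF sG Wq.
(* (T2) applied to [G] and itself has right-hand side 0, so [rho G] equals [rho] of its truncation
   at [tau'] without identifying the two CDFs. *)
have WGG : (wasserstein1 G G <= 0%:E)%E.
  apply: le_trans (wasserstein1_le G G) _.
  by rewrite integral0_eq// => t _; rewrite subrr normr0.
have := H G G 0 sG WGG; rewrite powR0 ?gt_eqF// mulr0 normr_le0 subr_eq0 => /eqP ->.
exact: H.
Qed.

Lemma trunc_fun_dist_le (tau : R) (F G : R -> R) z :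
  `|trunc_fun tau F z - trunc_fun tau G z| <= `|F z - G z|.
Proof.
rewrite /trunc_fun opprD addrACA subrr addr0 -mulrBl normrM.
by case: (_ <= z < tau); rewrite /= ?normr0 ?mulr0 ?normr1 ?mulr1.
Qed.

(** Moving the sample points slightly moves the truncated empirical CDF slightly in [W_1], and
    [rho_holder] applies since all these CDFs are supported in [[- tau, tau]]. Monotonicity of the
    probability in the theorem relies on it. *)
Lemma measurable_rho_trunc_ecdf n (n_gt0 : (0 < n)%N) tau : 0 < tau ->
  measurable_fun [set: n.-tuple R]
    (fun t => rho (trunc_cdf tau (ecdf n_gt0 (tnth t)))).
Proof.
move=> tau0; have [M M0 HM] := rho_holder tau tau0.
apply: measurable_fun_tuple_continuous => t e e0.
(* The solution of [M * q ^ alpha1 = e / 2]. *)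
pose q := (e / (2 * M)) `^ alpha1^-1.
have q0 : 0 < q by rewrite powR_gt0// divr_gt0// mulr_gt0.
exists q => // t' tt'.
apply: (@le_lt_trans _ _ (M * q `^ alpha1)); last first.
  rewrite /q -powRrM mulVf ?gt_eqF// powRr1; last by rewrite divr_ge0 ?mulr_ge0 ?ltW.
  rewrite (_ : M * _ = e / 2); first by rewrite ltr_pdivrMr// ltr_pMr// ltr1n.
  by field; rewrite gt_eqF.
apply: HM; [exact: trunc_cdf_supported..|].
apply: le_trans (wasserstein1_le _ _) _.
apply: (@le_trans _ _ (\int[leb]_s
    `|ecdf_fun n_gt0 (tnth t) s - ecdf_fun n_gt0 (tnth t') s|%:E)%E).
  have mE (G H : CDF R) : measurable_fun [set: R] (fun s => `|G s - H s|%:E).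
    apply/measurable_EFinP/measurableT_comp => //.
    by apply: measurable_funB; exact: measurable_CDF.
  apply: ge0_le_integral => //.
  - exact: (mE (trunc_cdf tau (ecdf n_gt0 (tnth t))) (trunc_cdf tau (ecdf n_gt0 (tnth t')))).
  - exact: (mE (ecdf n_gt0 (tnth t)) (ecdf n_gt0 (tnth t'))).
  - by move=> s _; rewrite lee_fin; exact: trunc_fun_dist_le.
apply: le_trans (integral_ecdf_dist_le n_gt0 t t') _.
rewrite lee_fin mulrC ler_pdivrMr ?ltr0n//.
apply: (@le_trans _ _ (\sum_(i < n) q)); first by apply: ler_sum => i _; exact: ltW.
by rewrite sumr_const card_ord mulr_natr.
Qed.

End type_T2_consequences.

Theorem theorem45 (R : realType) (c : R) (c_gt0 : 0 < c)
    (* X, a random variable with CDF F *)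
    (d : measure_display) (T : measurableType d) (P : probability T R)
    (X : {RV P >-> R}) (F : CDF R)
    (XF : forall r, cdf X r = (F r)%:E)
    (X_right : forall e : R, 0 <= e ->
       (P [set w | (e < X w)%R] <= (expR (- (c * e)))%:E)%E)
    (X_left : forall e : R, 0 <= e ->
       (P [set w | (X w <= - e)%R] <= (expR (- (c * e)))%:E)%E)
    (rho : CDF R -> R) (alpha1 alpha2 alpha3 L1 L2 L3 K1 K2 gamma : R)
    (rhoT2 : type_T2 rho alpha1 alpha2 alpha3 L1 L2 L3 K1 K2 gamma)
    (tau : R) (tau_gt0 : 0 < tau)
    (* X_1, ..., X_n, an i.i.d. sample from F *)
    (n : nat) (n_gt0 : (0 < n)%N)
    (d' : measure_display) (T' : measurableType d') (P' : probability T' R)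
    (Xs : 'I_n -> {RV P' >-> R})
    (Xs_iid : iid_with_cdf Xs F)
    (eps : R) (eps_gt0 : 0 < eps) :
  let rho_n (w : T') := rho (trunc_cdf tau (ecdf n_gt0 (fun i => Xs i w))) in
  let eps' := eps
    - L2 / (c * alpha2) * expR (- (alpha2 * c * K1 * tau))
    - L3 / (c * alpha3) * expR (- (alpha3 * c * K2 * tau)) in
  let a := (eps' / (L1 * tau `^ gamma)) `^ alpha1^-1 in
  let b := 384%:R / (c * Num.sqrt n%:R) in
  0 < eps' -> b < a ->
  (P' [set w | (eps < `|rho_n w - rho F|)%R]
    <= (expR (- (n%:R / (32%:R / c ^+ 2 + 4%:R / c * (a - b)) * (a - b) ^+ 2)))%:E)%E.
Proof.
move=> rho_n eps' a b eps'0 ba.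
have F_right s : 0 <= s -> 1 - F s <= expR (- (c * s)).
  move=> s0; rewrite -lee_fin EFinB -(XF s) -ccdf_1_cdf.
  apply: le_trans (X_right s s0); rewrite le_eqVlt; apply/orP; left; apply/eqP.
  by congr (P _); apply/seteqP; split => w /=; rewrite in_itv/= andbT.
have F_left s : 0 <= s -> F (- s) <= expR (- (c * s)).
  move=> s0; rewrite -lee_fin -(XF (- s)).
  apply: le_trans (X_left s s0); rewrite le_eqVlt; apply/orP; left; apply/eqP.
  by congr (P _); apply/seteqP; split => w /=; rewrite in_itv.
pose sample (w : T') : n.-tuple R := [tuple Xs i w | i < n].
have sampleE w : tnth (sample w) = (fun i => Xs i w).
  by apply/funext => i; rewrite tnth_mktuple.
have msample : measurable_fun [set: T'] sample.
  apply/measurable_fun_tnthP => i.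
  rewrite (_ : _ \o _ = Xs i); first exact: measurable_funPT.
  by apply/funext => w /=; rewrite tnth_mktuple.
pose sample_mixin := isMeasurableFun.Build _ _ _ _ sample msample.
pose samplef : {mfun T' >-> n.-tuple R} := HB.pack sample sample_mixin.
pose nu : probability (n.-tuple R) R := distribution P' samplef.
pose mu (i : 'I_n) : probability R R := distribution P' (Xs i).
have nuE A : (forall i, measurable (A i)) ->
    nu (box A) = (\prod_(i < n) mu i (A i))%E.
  (* Independence for the full index set is the box formula for the law of the sample. *)
  move=> mA; have := Xs_iid.1 (finset.setTfor 'I_n) A mA.
  rewrite (eq_bigl xpredT) => [<-|i]; last by rewrite finset.in_setT.
  rewrite /nu /distribution /pushforward/=; congr (P' _).
  apply/seteqP; split => w /=.
    by move=> Aw i _ /=; have := Aw i; rewrite sampleE.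
  by move=> Aw i; rewrite sampleE; apply: Aw; rewrite /= finset.in_setT.
have muF i r : mu i [set x | (x <= r)%R] = (F r)%:E.
  have -> : [set x : R | x <= r] = `]-oo, r]%classic.
    by apply/seteqP; split => x /=; rewrite in_itv.
  exact: (Xs_iid.2 i r).
set wd := a - b; have wd0 : 0 < wd by rewrite subr_gt0.
have rn0 : 0 < Num.sqrt (n%:R : R) by rewrite sqrtr_gt0 ltr0n.
have Lt0 : 0 < L1 * tau `^ gamma.
  by case: rhoT2 => _ [L10 _ _] _ _; rewrite mulr_gt0// powR_gt0.
have a1 : 0 < alpha1 by case: rhoT2 => [[/andP[]]].
(* [a] is the [W_1] level at which the first term of (T2) uses up all of [eps']. *)
have aE : L1 * a `^ alpha1 * tau `^ gamma = eps'.
  rewrite /a -powRrM mulVf ?gt_eqF// powRr1; last by rewrite divr_ge0 ?ltW.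
  by rewrite mulrAC mulrC divfK// gt_eqF.
(* The mean bound has constant 4 while [b] has 384, so the threshold of [deviation_tail_le] with
   [w = a - b] stays below [a]. *)
have le_a : 4 / (c * Num.sqrt n%:R) + wd <= a.
  rewrite /wd addrCA gerDl subr_le0 /b ler_pM2r ?invr_gt0 ?mulr_gt0//.
  by rewrite ler_nat.
pose dev := deviation n_gt0 F.
pose E := [set t : n.-tuple R | ((4 / (c * Num.sqrt n%:R) + wd)%:E < dev t)%E].
have mE : measurable E.
  have := measurable_deviation n_gt0 F.
  move=> /(emeasurable_fun_o_infty measurableT)/(_ (4 / (c * Num.sqrt n%:R) + wd)%:E).
  by rewrite setTI.
(* By contraposition: a deviation of at most [a] bounds [W_1] by [a], and then (T2) bounds the error
   of [rho_n] by [eps]. *)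
have sub : [set w | (eps < `|rho_n w - rho F|)%R] `<=` samplef @^-1` E.
  move=> w /=; rewrite /E/= !ltNge; apply: contra => dev_le.
  rewrite distrC.
  have Wle : (wasserstein1 F (ecdf n_gt0 (fun i => Xs i w)) <= a%:E)%E.
    apply: le_trans (wasserstein1_le _ _) _; rewrite -sampleE.
    by apply: le_trans dev_le _; rewrite lee_fin.
  have := rho_truncation_le _ _ _ _ _ _ _ _ _ _ rhoT2 F _ tau c a tau_gt0 c_gt0
    F_right F_left Wle.
  by move=> /le_trans; apply; rewrite aE /eps'; lra.
have mrho : measurable [set w | (eps < `|rho_n w - rho F|)%R].
  have mr := measurable_rho_trunc_ecdf _ _ _ _ _ _ _ _ _ _ rhoT2 n n_gt0 tau tau_gt0.
  have mr' : measurable_fun [set: T'] (fun w => `|rho_n w - rho F|).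
    apply: measurableT_comp => //; apply: measurable_funB => //.
    rewrite (_ : rho_n = (fun t => rho (trunc_cdf tau (ecdf n_gt0 (tnth t)))) \o sample).
      exact: (measurableT_comp mr msample).
    by apply/funext => w /=; rewrite sampleE.
  have := measurable_fun_ltr (measurable_cst eps) mr'.
  by move=> /(_ measurableT [set true]); rewrite setTI; apply.
apply: (@le_trans _ _ (nu E)).
  rewrite /nu /distribution /pushforward/=.
  apply: le_measure; rewrite ?inE//.
  by rewrite -[X in measurable X]setTI; exact: (msample measurableT _ mE).
apply: le_trans (deviation_tail_le n_gt0 F nu mu nuE muF c c_gt0 F_right F_left wd wd0) _.
rewrite lee_fin ler_expR le_eqVlt; apply/orP; left; apply/eqP.
congr (- _); field.
by rewrite !gt_eqF//= ?addr_gt0 ?mulr_gt0.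
Qed.
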